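(* Let $(X_t^{(n)})_{n\ge1}$ be a sequence of irreducible continuous-time birth-and-death chains, with mixing times $t_{\mathrm{mix}}^{(n)}(\cdot)$ and relaxation times $t_{\mathrm{rel}}^{(n)}$. Then $(X_t^{(n)})$ exhibits cutoff in total variation if and only if $t_{\mathrm{rel}}^{(n)}=o\big(t_{\mathrm{mix}}^{(n)}(\frac14)\big)$ as $n\to\infty$, and the cutoff window size is at most $\sqrt{t_{\mathrm{mix}}^{(n)}(\frac14)\cdot t_{\mathrm{rel}}^{(n)}}$; that is, when cutoff occurs, $w_n=\sqrt{t_{\mathrm{mix}}^{(n)}(\frac14)\cdot t_{\mathrm{rel}}^{(n)}}$ is a cutoff window for the sequence.
   Context: A continuous-time birth-and-death chain has state space $\Omega=\{0,\ldots,N\}$ for some integer $N\ge1$ (which may differ from chain to chain) and heat kernel $H_t(x,y)=\mathbb P_x(X_t=y)$, $H_t=\mathrm e^{t(P-I)}$ for real $t\ge0$, where $P$ is a stochastic matrix on $\Omega$ with $P(x,y)=0$ whenever $|x-y|>1$; no laziness of $P$ is assumed. It is irreducible if $P$ is. Let $\pi$ be the stationary distribution. With $\|\mu-\nu\|_{\mathrm{TV}}=\frac12\sum_x|\mu(x)-\nu(x)|$, put $d(t)=\max_{x\in\Omega}\|H_t(x,\cdot)-\pi\|_{\mathrm{TV}}$ and $t_{\mathrm{mix}}(\epsilon)=\min\{t\ge0:d(t)\le\epsilon\}$ for $0<\epsilon<1$. The spectral gap of the continuous-time chain is the smallest nonzero eigenvalue of $I-P$, and $t_{\mathrm{rel}}$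 is its reciprocal. A superscript $(n)$ indicates the quantity for the $n$-th chain. The sequence exhibits cutoff (in total variation) if $\lim_{n\to\infty} t_{\mathrm{mix}}^{(n)}(\epsilon)/t_{\mathrm{mix}}^{(n)}(1-\epsilon)=1$ for every $0<\epsilon<1$. A sequence $w_n$ is a cutoff window if $w_n=o\big(t_{\mathrm{mix}}^{(n)}(\frac14)\big)$ and for every $\epsilon\in(0,1)$ there is $c_\epsilon>0$ such that $t_{\mathrm{mix}}^{(n)}(\epsilon)-t_{\mathrm{mix}}^{(n)}(1-\epsilon)\le c_\epsilon w_n$ for all $n$. *)

(* Defs.v *)
From HB Require Import structures.
From mathcomp Require Import all_boot all_order all_algebra.
From mathcomp Require Import all_classical all_reals all_analysis.

Set Implicit Arguments.
Unset Strict Implicit.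
Unset Printing Implicit Defensive.

Import Order.TTheory GRing.Theory Num.Theory.
Import numFieldNormedType.Exports.

Local Open Scope classical_set_scope.
Local Open Scope ring_scope.

(* The least element of A; by convention 0 when A has none. *)
Definition set_min (R : realType) (A : set R) : R := xget 0 (A `&` lbound A).

Definition stochastic (R : realType) (N : nat) (P : 'M[R]_N.+1) : Prop :=
  (forall x y, 0 <= P x y) /\ (forall x, \sum_y P x y = 1).

Record bd_chain (R : realType) := BDChain {
  bd_top : nat;
  bd_top_gt0 : (0 < bd_top)%N;
  bd_P : 'M[R]_bd_top.+1;
  bd_stochastic : stochastic bd_P;
  bd_nearest : forall x y : 'I_bd_top.+1, (1 < `|x - y|)%N -> bd_P x y = 0 }.

Definition irreducible (R : realType) (X : bd_chain R) : Prop :=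
  forall x y, exists k : nat, 0 < (bd_P X ^+ k) x y.

Definition is_stationary (R : realType) (N : nat) (P : 'M[R]_N.+1)
    (mu : 'rV[R]_N.+1) : Prop :=
  [/\ forall x, 0 <= mu 0 x, \sum_x mu 0 x = 1 & mu *m P = mu].

(* Chosen among all stationary distributions of the chain; there is exactly
   one as soon as the chain is irreducible. *)
Definition stationary (R : realType) (X : bd_chain R) : 'rV[R]_(bd_top X).+1 :=
  xget 0 [set mu | is_stationary (bd_P X) mu].

(* Matrix exponential, as the entrywise sum of the exponential series. *)
Definition expmx (R : realType) (N : nat) (A : 'M[R]_N.+1) : 'M[R]_N.+1 :=
  \matrix_(x, y) limn [series (k`!%:R^-1 *: A ^+ k) x y]_k.

Definition heat_kernel (R : realType) (X : bd_chain R) (t : R) :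
    'M[R]_((bd_top X).+1) :=
  expmx (t *: (bd_P X - 1)).

Definition tv_dist (R : realType) (N : nat) (mu nu : 'rV[R]_N.+1) : R :=
  2^-1 * \sum_x `|mu 0 x - nu 0 x|.

(* The default value 0 of the maximum is harmless, as distances are >= 0. *)
Definition mix_dist (R : realType) (X : bd_chain R) (t : R) : R :=
  \big[Num.max/0]_x tv_dist (row x (heat_kernel X t)) (stationary X).

Definition tmix (R : realType) (X : bd_chain R) (eps : R) : R :=
  set_min [set t | 0 <= t /\ mix_dist X t <= eps].

(* Only real eigenvalues are considered: an irreducible birth-and-death chain is
   reversible, so 1 - P is diagonalizable over the reals. *)
Definition spectral_gap (R : realType) (X : bd_chain R) : R :=
  set_min [set a | eigenvalue (1 - bd_P X) a /\ a != 0].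

Definition trel (R : realType) (X : bd_chain R) : R := (spectral_gap X)^-1.

(* The total inverse sends 0 to 0, so a vanishing denominator counts against
   convergence to 1. *)
Definition cutoff (R : realType) (X : nat -> bd_chain R) : Prop :=
  forall eps : R, 0 < eps < 1 ->
    tmix (X n) eps / tmix (X n) (1 - eps) @[n --> \oo] --> (1 : R).

Definition cutoff_window (R : realType) (X : nat -> bd_chain R)
    (w : nat -> R) : Prop :=
  (w =o_\oo (fun n => tmix (X n) 4^-1)) /\
  (forall eps : R, 0 < eps < 1 -> exists2 c : R, 0 < c &
     forall n, tmix (X n) eps - tmix (X n) (1 - eps) <= c * w n).

(* Main.v *)
Require Import Defs.
From HB Require Import structures.
From mathcomp Require Import all_boot all_order all_algebra.
From mathcomp Require complex.
From mathcomp Require Import all_classical all_reals all_analysis.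
From mathcomp Require Import ring lra zify.

(* Everything is done on the semigroup H_t; no path space is needed.  Let m be a
   median of pi, tau its hitting time, u(x) = E_x tau, w(x) = E_x tau^2 and
   a = u(0); u and w are explicit sums solving Poisson equations.  The Poincare
   inequality for the functions E_x tau_(k+1) gives Var_0 tau <= 4 trel a, and
   differentiating H_t [w + 2 (t - a) u + (t - a)^2] at 0 gives
   E_0 (u(X_t) + t - a)^2 <= 8 trel a for t <= a.  Before a - C sqrt(trel a) the
   chain started at 0 is thus to the left of most of the mass of pi.  At time a,
   E_0 u(X_t) = O(sqrt(trel a)), and this expectation decreases at a positive rate
   until X_t has reached any given quantile with high probability.  The same holds
   from the right end by reflection; monotonicity of H_t extends it to all starting
   points; and from the bulk, where the resistance is O(trel), mixing takes time
   O(trel).  Hence tmix(eps) and tmix(1 - eps) differ by O(sqrt(trel tmix(1/4))).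
   Conversely d(t) >= exp(- t / trel) / 2, so cutoff forces trel = o(tmix(1/4)). *)

Set Implicit Arguments.
Unset Strict Implicit.
Unset Printing Implicit Defensive.

Import Order.TTheory GRing.Theory Num.Theory.
Import numFieldNormedType.Exports.

Local Open Scope classical_set_scope.
Local Open Scope ring_scope.

(** * Spectral theorem for real symmetric matrices *)

(** The obstacle is that [u] and [w] stop solving their equations at [m]: there [L u] and [L w]
    carry a nonnegative flux from below, which enters the derivative estimates with the weight
    [ker s 0 m / pim m]. The density of the chain started at 0 is nonincreasing, so at a median this
    weight is at most 2. Monotonicity of the semigroup is therefore the central input; as no
    laziness is assumed, it is obtained from [H_t = exp(-2 t) exp(2 t (I + L / 2))], a series in a
    lazy step. The probabilistic part is written for an abstract [bd_flow], a notion closed under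
    reflection, so that the right end needs no second proof. Chains enter through the real spectral
    theorem, which supplies the kernel expansion, the Poincare inequality and, by way of a Green
    function, the smoothing used in the bulk. *)

Section RealSpectral.
Import complex.
Context {R : rcfType}.
Local Notation C := (complex R).
Local Notation toC := (map_mx (real_complex R)).

Lemma map_Re_mul m n q (Z : 'M[C]_(m, n)) (A : 'M[R]_(n, q)) :
  map_mx (@Re R) (Z *m toC A) = map_mx (@Re R) Z *m A.
Proof.
apply/matrixP => i j; rewrite !mxE (raddf_sum (@Re R : Rcomplex R -> R)).
by apply: eq_bigr => k _; rewrite !mxE; case: (Z i k) => a b /=; rewrite mulr0 subr0.
Qed.

Lemma map_Im_mul m n q (Z : 'M[C]_(m, n)) (A : 'M[R]_(n, q)) :
  map_mx (@Im R) (Z *m toC A) = map_mx (@Im R) Z *m A.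
Proof.
apply/matrixP => i j; rewrite !mxE (raddf_sum (@Im R : Rcomplex R -> R)).
by apply: eq_bigr => k _; rewrite !mxE; case: (Z i k) => a b /=; rewrite mulr0 add0r.
Qed.

(* A complex eigenvector of A, projected off the rows of V, stays an
   eigenvector; its real or its imaginary part is the required vector. *)
Lemma eigenvector_orthogonal k n (A : 'M[R]_n) (V : 'M[R]_(k, n)) (d : 'rV[R]_k) :
    A^T = A -> V *m V^T = 1%:M -> V *m A = diag_mx d *m V -> (k < n)%N ->
  exists (w : 'rV[R]_n) a, [/\ w != 0, w *m V^T = 0 & w *m A = a *: w].
Proof.
move=> As VV VA kn.
have Ah : toC A \is hermsymmx.
  apply: realsym_hermsym.
    by apply/is_hermitianmxP; rewrite expr0 scale1r; apply/matrixP => i j;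
      rewrite !mxE -[in LHS]As mxE.
  apply/mxOverP => i j; rewrite !mxE.
  by apply/complex_realP; exists (A i j).
have dr := hermitian_spectral_diag_real Ah.
have /orthomx_spectralP Ae := hermitian_normalmx Ah.
set M := spectralmx (toC A) in Ae; set X := spectral_diag (toC A) in dr Ae.
have Mu : M \in unitmx by exact: spectral_unit.
have MA : M *m toC A = diag_mx X *m M by rewrite Ae !mulmxA mulmxV// mul1mx.
(* The [n] rows of the invertible [M] cannot all lie in the span of the [k < n] rows of [V]. *)
have /row_subPn[i Mi] : ~~ (M <= toC V)%MS.
  apply/negP => /mxrankS; rewrite mxrank_unit// leqNgt => /negP; apply.
  by apply: leq_ltn_trans kn; exact: rank_leq_row.
set m := row i M in Mi.
have mA : m *m toC A = X 0 i *: m by rewrite -row_mul MA row_mul row_diag_mx -scalemxAl -rowE.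
(* Orthogonal projection onto the row space of [V]. It commutes with [A], since that space is
   invariant. *)
pose Q := toC (V^T *m V).
have AV : A *m V^T = V^T *m diag_mx d.
  by apply: trmx_inj; rewrite !trmx_mul !trmxK tr_diag_mx As.
have QA : Q *m toC A = toC A *m Q.
  by rewrite /Q -!map_mxM; congr (map_mx _ _); rewrite -mulmxA VA !mulmxA AV.
pose r := m - m *m Q.
have rA : r *m toC A = X 0 i *: r.
  by rewrite mulmxBl -mulmxA QA mulmxA mA -scalemxAl -scalerBr.
have rV : r *m toC V^T = 0.
  rewrite mulmxBl -mulmxA /Q -map_mxM -mulmxA VV mulmx1 subrr//.
have r0 : r != 0.
  apply: contra Mi; rewrite subr_eq0 => /eqP ->.
  by rewrite /Q map_mxM mulmxA submxMl.
have /complex_realP[a Xa] : X 0 i \is Num.real by move/mxOverP: dr; exact.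
rewrite Xa in rA; clearbody r.
have [Re0|Re_neq0] := eqVneq (map_mx (@Re R) r) 0; last first.
  exists (map_mx (@Re R) r), a; split => //.
    by rewrite -map_Re_mul rV; apply/matrixP => ? ?; rewrite !mxE.
  rewrite -map_Re_mul rA; apply/matrixP => u v; rewrite !mxE.
  by case: (r u v) => x y /=; rewrite mul0r subr0.
exists (map_mx (@Im R) r), a; split.
- apply: contraNneq r0 => Im0; apply/eqP/matrixP => u v.
  have := congr1 (fun B : 'M[R]_(_, _) => B u v) Re0.
  have := congr1 (fun B : 'M[R]_(_, _) => B u v) Im0.
  by rewrite !mxE; case: (r u v) => x y /= -> ->.
- by rewrite -map_Im_mul rV; apply/matrixP => ? ?; rewrite !mxE.
- rewrite -map_Im_mul rA; apply/matrixP => u v; rewrite !mxE.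
  by case: (r u v) => x y /=; rewrite mul0r addr0.
Qed.

(** Orthonormal eigenvectors are collected one row at a time: induction on the number [k] of rows,
    each new one taken orthogonal to the previous ones and normalized. *)
Theorem symmetric_spectral n (A : 'M[R]_n) : A^T = A ->
  exists (V : 'M[R]_n) (d : 'rV[R]_n), V *m V^T = 1%:M /\ V *m A = diag_mx d *m V.
Proof.
move=> As.
suff H k : (k <= n)%N -> exists (V : 'M[R]_(k, n)) (d : 'rV[R]_k),
  V *m V^T = 1%:M /\ V *m A = diag_mx d *m V by exact: H.
elim: k => [|k IH] kn.
  by exists 0, 0; split; rewrite ?mul0mx ?mulmx0//; apply/matrixP => -[].
have [V [d [VV VA]]] := IH (ltnW kn).
have [w [a [w0 wV wA]]] := eigenvector_orthogonal As VV VA kn.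
pose q := (w *m w^T) 0 0.
have q0 : 0 < q.
  rewrite /q mxE; have [j wj] : exists j, w 0 j != 0.
    by apply/existsP; apply: contra_neqT w0; rewrite negb_exists => /forallP w0;
      apply/rowP => j; rewrite mxE; apply/eqP; rewrite -[_ == _]negbK.
  rewrite (bigD1 j)//= ltr_pwDl//.
    by rewrite mxE -expr2 lt_def sqrf_eq0 wj sqr_ge0.
  by apply: sumr_ge0 => l _; rewrite mxE -expr2 sqr_ge0.
pose v := (Num.sqrt q)^-1 *: w.
have vv : v *m v^T = 1%:M.
  rewrite /v [(_ *: w)^T]linearZ/= -scalemxAl -scalemxAr scalerA.
  rewrite [w *m w^T]mx11_scalar -/q scale_scalar_mx -invfM -expr2.
  by rewrite sqr_sqrtr ?ltW// mulVf ?gt_eqF.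
have vV : v *m V^T = 0 by rewrite -scalemxAl wV scaler0.
have vA : v *m A = a *: v by rewrite -scalemxAl wA !scalerA mulrC.
have k1 : k.+1 = (k + 1)%N by rewrite addn1.
rewrite k1.
exists (col_mx V v), (row_mx d (const_mx a)); split.
  rewrite tr_col_mx mul_col_row VV vv vV.
  rewrite -[V *m v^T]trmxK trmx_mul trmxK vV trmx0.
  by rewrite scalar_mx_block.
rewrite mul_col_mx VA vA diag_mx_row mul_block_col !mul0mx addr0 add0r; congr col_mx.
by rewrite diag_const_mx mul_scalar_mx.
Qed.
End RealSpectral.

(** * Sums over integer intervals and a mean value inequality *)

(** With [W] the total weight, expanding the nonnegative sum of [w x * (W * f x - A) ^+ 2] gives the
    claim times [W]. If [W = 0], every weight vanishes. *)
Lemma weighted_cauchy_schwarz (R : realFieldType) (w f : nat -> R) (i n : nat) :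
    (forall x, (i <= x < n)%N -> 0 <= w x) ->
  (\sum_(i <= x < n) w x * f x) ^+ 2 <=
    (\sum_(i <= x < n) w x) * \sum_(i <= x < n) w x * f x ^+ 2.
Proof.
move=> w0; set W := \sum_(i <= x < n) w x; set A := \sum_(i <= x < n) _ * f _.
set B := \sum_(i <= x < n) _.
have W0 : 0 <= W by rewrite /W big_nat; apply: sumr_ge0 => x /w0.
have key : 0 <= W * (W * B - A ^+ 2).
  have -> : W * (W * B - A ^+ 2) = \sum_(i <= x < n) w x * (W * f x - A) ^+ 2.
    under eq_bigr => x _.
      rewrite (_ : _ * _ = W ^+ 2 * (w x * f x ^+ 2) - 2 * W * A * (w x * f x)
        + A ^+ 2 * w x); last by ring.
      over.
    rewrite big_split/= sumrB -!mulr_sumr -/W -/A -/B; ring.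
  by rewrite big_nat; apply: sumr_ge0 => x /w0 ?; rewrite mulr_ge0 ?sqr_ge0.
have [W_eq0|W_neq0] := eqVneq W 0; last first.
  by rewrite -subr_ge0 -(@pmulr_rge0 _ W)// lt_def W_neq0.
suff -> : A = 0 by rewrite W_eq0 mul0r expr0n.
rewrite /A big_nat big1 // => x xin.
suff -> : w x = 0 by rewrite mul0r.
apply/eqP; rewrite eq_le w0// andbT -W_eq0 /W.
rewrite (bigD1_seq x) ?mem_index_iota ?iota_uniq//=.
  by rewrite lerDl big_nat_cond; apply: sumr_ge0 => y /andP[/w0].
Qed.

Lemma le_sum_nat (R : numDomainType) (f g : nat -> R) (i n : nat) :
    (forall x, (i <= x < n)%N -> f x <= g x) ->
  \sum_(i <= x < n) f x <= \sum_(i <= x < n) g x.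
Proof. by move=> fg; rewrite big_nat [leRHS]big_nat; apply: ler_sum => x /fg. Qed.

Lemma sum_nat_ge0 (R : numDomainType) (f : nat -> R) (i n : nat) :
  (forall x, (i <= x < n)%N -> 0 <= f x) -> 0 <= \sum_(i <= x < n) f x.
Proof. by move=> f0; rewrite big_nat; apply: sumr_ge0 => x /f0. Qed.

Lemma sum_nat_split (V : nmodType) (F : nat -> V) (k i n : nat) :
  (i <= k)%N -> (k <= n)%N ->
  \sum_(i <= x < n) F x = \sum_(i <= x < k) F x + \sum_(k <= x < n) F x.
Proof. exact: big_cat_nat. Qed.

Lemma sum_nat_eq0 (V : nmodType) (F : nat -> V) (i n : nat) :
  (forall x, (i <= x < n)%N -> F x = 0) -> \sum_(i <= x < n) F x = 0.
Proof. by move=> F0; rewrite big_nat big1. Qed.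

Lemma le_derive_bound (R : realType) (F dF : R -> R) (a b K : R) : a <= b ->
    (forall s, is_derive s (1 : R) F (dF s)) ->
    (forall s, a <= s <= b -> dF s <= K) ->
  F b <= F a + K * (b - a).
Proof.
move=> ab dFx le_dF.
have Fc : {within `[a, b], continuous F}.
  by apply: derivable_within_continuous => s _; exact: ex_derive.
have [z] := MVT_segment ab (fun s _ => dFx s) Fc.
rewrite in_itv/= => zab e; rewrite -lerBlDl e.
by rewrite ler_wpM2r ?subr_ge0// le_dF.
Qed.

(** * Birth-and-death semigroups *)

Section Operators.
Context {R : realType} (N : nat) (p c : nat -> R).

Definition mean (f : nat -> R) : R := \sum_(0 <= y < N.+1) p y * f y.

(** For a reversible chain with [c x = p x * P(x, x+1)] this is [(P - I) f]; the holding
    probabilities cancel. *)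
Definition gen (f : nat -> R) (x : nat) : R :=
  (c x * (f x.+1 - f x) + c x.-1 * (f x.-1 - f x)) / p x.

(** The Dirichlet form of the path with conductances [c]. *)
Definition energy (f : nat -> R) : R :=
  \sum_(0 <= x < N) c x * (f x.+1 - f x) ^+ 2.

Lemma energy_ge0 f : (forall x, (x < N)%N -> 0 < c x) -> 0 <= energy f.
Proof.
move=> c0; apply: sum_nat_ge0 => x /andP[_ xN].
by rewrite mulr_ge0 ?sqr_ge0// ltW// c0.
Qed.

End Operators.

Definition evolve {R : realType} (N : nat) (h : R -> nat -> nat -> R) (t : R)
    (f : nat -> R) (x : nat) : R :=
  \sum_(0 <= y < N.+1) h t x y * f y.

(* [cond x] is the conductance of the edge {x, x+1}.  States are natural numbers
   up to [top]; [cond top = 0] and [0.-1 = 0] make [gen] correct at both ends. *)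
Record bd_flow (R : realType) := BDFlow {
  top : nat;
  pim : nat -> R;
  cond : nat -> R;
  ker : R -> nat -> nat -> R;
  relax : R;
  pim_gt0 : forall x, (x <= top)%N -> 0 < pim x;
  pim_sum1 : \sum_(0 <= x < top.+1) pim x = 1;
  cond_gt0 : forall x, (x < top)%N -> 0 < cond x;
  cond_top : cond top = 0;
  ker_ge0 : forall (t : R) x y, 0 <= t -> (x <= top)%N -> (y <= top)%N ->
    0 <= ker t x y;
  ker_sum1 : forall (t : R) x, 0 <= t -> (x <= top)%N ->
    \sum_(0 <= y < top.+1) ker t x y = 1;
  ker_0 : forall x y, (x <= top)%N -> (y <= top)%N -> ker 0 x y = (x == y)%:R;
  ker_add : forall s t x y, (x <= top)%N -> (y <= top)%N ->
    ker (s + t) x y = \sum_(0 <= z < top.+1) ker s x z * ker t z y;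
  ker_rev : forall t x y, (x <= top)%N -> (y <= top)%N ->
    pim x * ker t x y = pim y * ker t y x;
  ker_mono : forall (t : R) (f : nat -> R), 0 <= t -> (forall x, (x < top)%N -> f x.+1 <= f x) ->
    forall x, (x < top)%N -> evolve top ker t f x.+1 <= evolve top ker t f x;
  ker_derive : forall (f : nat -> R) (t : R) x, (x <= top)%N ->
    is_derive t (1 : R) (fun s : R => evolve top ker s f x)
      (evolve top ker t (gen pim cond f) x);
  relax_gt0 : 0 < relax;
  poincare : forall f : nat -> R, mean top pim (fun x => f x ^+ 2) - mean top pim f ^+ 2 <=
    relax * energy top cond f;
  smoothing : forall z, (z <= top)%N -> exists f : nat -> R,
    [/\ mean top pim f = 0, f z = energy top cond f &
      forall s : R, 0 < s ->
        mean top pim (fun y => (ker s z y / pim y - 1) ^+ 2) <= f z / (2 * s)] }.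

(** * Poisson equations and mean hitting times *)

Section Core.
Context {R : realType} (B : bd_flow R).
Local Notation N := (top B).
Local Notation p := (pim B).
Local Notation c := (cond B).
Local Notation h := (ker B).
Local Notation rel := (relax B).
Local Notation E := (mean N p).
Local Notation H := (evolve N h).
Local Notation L := (gen p c).
Implicit Types (f g : nat -> R) (x y z k m i j : nat).

(** The bound [n] is excluded: [m] is a median when [cdf m <= 1/2 <= cdf m.+1], and the total mass
    is [cdf N.+1]. *)
Definition cdf (n : nat) : R := \sum_(0 <= y < n) p y.
Local Notation Pi := cdf.

Lemma cdfS n : Pi n.+1 = Pi n + p n.
Proof. by rewrite /cdf big_nat_recr. Qed.

Lemma le_cdf i j : (i <= j)%N -> (j <= N.+1)%N -> Pi i <= Pi j.
Proof.
move=> ij jN; rewrite /cdf (sum_nat_split _ (leq0n i) ij) lerDl.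
by apply: sum_nat_ge0 => x /andP[_ xj]; apply/ltW/pim_gt0; lia.
Qed.

Lemma cdf_top : Pi N.+1 = 1. Proof. exact: pim_sum1. Qed.

Lemma cdf_ge0 i : (i <= N.+1)%N -> 0 <= Pi i.
Proof. by move=> iN; rewrite -[0](_ : Pi 0 = _) ?le_cdf// /cdf big_geq. Qed.

Lemma cdf_le1 i : (i <= N.+1)%N -> Pi i <= 1.
Proof. by move=> iN; rewrite -cdf_top le_cdf. Qed.

Lemma cdf_gt0 i : (i <= N)%N -> 0 < Pi i.+1.
Proof. by move=> iN; rewrite cdfS ltr_wpDl ?pim_gt0// cdf_ge0// ltnW. Qed.

(* [hit m g x] is the expected integral of [g] along the path up to the hitting
   time of [m] from [x <= m]; it solves the Poisson equation below. *)
Definition hit m g x : R :=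
  \sum_(x <= z < m) (\sum_(0 <= y < z.+1) p y * g y) / c z.

Lemma hitS m g x : (x < m)%N ->
  hit m g x = (\sum_(0 <= y < x.+1) p y * g y) / c x + hit m g x.+1.
Proof. by move=> xm; rewrite /hit big_ltn. Qed.

Lemma hit0 m g x : (m <= x)%N -> hit m g x = 0.
Proof. by move=> mx; rewrite /hit big_geq. Qed.

Lemma hit_diff m g x : (x < m)%N -> (m <= N)%N ->
  c x * (hit m g x.+1 - hit m g x) = - \sum_(0 <= y < x.+1) p y * g y.
Proof.
move=> xm mN; have := @cond_gt0 _ B x (leq_trans xm mN).
by rewrite (hitS _ xm) => cx; field; rewrite gt_eqF.
Qed.

Lemma gen_hit_below m g x : (x < m)%N -> (m <= N)%N -> L (hit m g) x = - g x.
Proof.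
move=> xm mN; have px : 0 < p x by rewrite pim_gt0//; lia.
rewrite /gen hit_diff//.
suff -> : c x.-1 * (hit m g x.-1 - hit m g x) = \sum_(0 <= y < x) p y * g y.
  by rewrite big_nat_recr//=; field; rewrite gt_eqF.
case: x xm {px} => [|x] xm; first by rewrite /= subrr mulr0 big_geq.
by rewrite -[LHS]opprK -mulrN opprB hit_diff ?opprK//; lia.
Qed.

(** [hit m g] vanishes from [m] on, so only the flux over the edge below [m] survives. This is the
    error term in the later derivative estimates. *)
Lemma gen_hit_at m g : (m <= N)%N ->
  L (hit m g) m = (\sum_(0 <= y < m) p y * g y) / p m.
Proof.
move=> mN; rewrite /gen (hit0 _ (leqnn m)) (hit0 _ (leqnSn m)) subrr mulr0 add0r; congr (_ / _).
case: m mN => [|m] mN; first by rewrite /= hit0// subrr mulr0 big_geq.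
have := hit_diff g (ltnSn m) mN; rewrite [hit _ _ m.+1]hit0// => /(congr1 -%R).
by rewrite opprK -mulrN opprB.
Qed.

Lemma gen_hit_above m g x : (m < x)%N -> L (hit m g) x = 0.
Proof. 
move=> mx; rewrite /gen !hit0; try lia.
by rewrite subrr !mulr0 addr0 mul0r. Qed.

Definition ehit m : nat -> R := hit m (fun=> 1).

Lemma ehit0 m x : (m <= x)%N -> ehit m x = 0. Proof. exact: hit0. Qed.

Lemma ehitE m x : ehit m x = \sum_(x <= z < m) Pi z.+1 / c z.
Proof.
apply: eq_bigr => z _; congr (_ / _).
by apply: eq_bigr => y _; rewrite mulr1.
Qed.

Lemma ehit_ge0 m x : (m <= N)%N -> 0 <= ehit m x.
Proof.
move=> mN; rewrite ehitE; apply: sum_nat_ge0 => z /andP[_ zm].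
by rewrite divr_ge0 ?cdf_ge0 ?(ltW (cond_gt0 _))//; lia.
Qed.

Lemma ehitS m x : (x < m)%N -> ehit m x = Pi x.+1 / c x + ehit m x.+1.
Proof. by move=> xm; rewrite !ehitE big_ltn. Qed.

Lemma ehit_cat m k x : (x <= k)%N -> (k <= m)%N ->
  ehit m x = ehit k x + ehit m k.
Proof. by move=> xk km; rewrite !ehitE (sum_nat_split _ xk km). Qed.

(** Raising [k] by one adds the constant [Pi k.+1 / c k] to the hitting time on [0, k], a set of
    mass [Pi k.+1]. *)
Lemma mean_ehit k : (k <= N)%N ->
  E (ehit k) = \sum_(0 <= z < k) Pi z.+1 ^+ 2 / c z.
Proof.
move=> kN; have -> : E (ehit k) = \sum_(0 <= y < k) p y * ehit k y.
  rewrite /mean (sum_nat_split _ (leq0n k)); last by lia.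
  rewrite [X in _ + X]sum_nat_eq0 ?addr0// => y /andP[ky _].
  by rewrite ehit0// mulr0.
elim: k kN => [|k IH] kN; first by rewrite !big_geq.
rewrite [RHS]big_nat_recr//= -IH; last by lia.
rewrite big_nat_recr//=.
have ek y : (y <= k)%N -> ehit k.+1 y = ehit k y + Pi k.+1 / c k.
  by move=> yk; rewrite (ehit_cat yk)// (ehitS (ltnSn k)) [ehit k.+1 k.+1]ehit0// addr0.
rewrite (eq_big_nat _ _ (F2 := fun y => p y * ehit k y + p y * (Pi k.+1 / c k))).
  rewrite big_split/= -mulr_suml -/(cdf k) ek// [ehit k k]ehit0//.
  rewrite add0r -addrA -mulrDl -cdfS; ring.
by move=> y /andP[_ yk]; rewrite ek ?mulrDr//; lia.
Qed.

(** Integration by parts: [L (ehit k) = -1] wherever [ehit k] is nonzero. The Poincare inequality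
    thereby bounds the variance of [ehit k] by its own mean. *)
Lemma energy_ehit k : (k <= N)%N -> energy N c (ehit k) = E (ehit k).
Proof.
move=> kN; rewrite mean_ehit// /energy [LHS](big_cat_nat _ kN)//=.
rewrite [X in _ + X]big_nat [X in _ + X]big1 ?addr0; last first.
  by move=> y /andP[ky _]; rewrite !ehit0 ?subrr ?expr0n ?mulr0//; lia.
apply: eq_big_nat => x /andP[_ xk].
have cx : 0 < c x by rewrite cond_gt0//; lia.
by rewrite (ehitS xk); field; rewrite gt_eqF.
Qed.

(* Poincare inequality applied to [ehit k], which vanishes on [k, N]. *)
Lemma mean_ehit_le k : (k <= N)%N -> E (ehit k) * (1 - Pi k) <= rel * Pi k.
Proof.
move=> kN; set F := E (ehit k); set S := E (fun x => ehit k x ^+ 2).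
have F0 : 0 <= F.
  apply: sum_nat_ge0 => x /andP[_ xN].
  by rewrite mulr_ge0 ?ehit_ge0 ?(ltW (pim_gt0 _)).
have cut f : (forall x, (k <= x)%N -> f x = 0) ->
    E f = \sum_(0 <= y < k) p y * f y.
  move=> f0; rewrite /mean (sum_nat_split _ (leq0n k)); last by lia.
  rewrite [X in _ + X]sum_nat_eq0 ?addr0// => y /andP[ky _].
  by rewrite f0// mulr0.
(* Cauchy-Schwarz on the support [0, k). With [S - F ^+ 2 <= rel * F] it gives
   [F ^+ 2 * (1 - Pi k) <= Pi k * (rel * F)], to be divided by [F]. *)
have FS : F ^+ 2 <= Pi k * S.
  rewrite /F /S !cut => [|x kx|x kx]; try by rewrite ehit0 ?expr0n.
  apply: weighted_cauchy_schwarz => x /andP[_ xk].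
  by rewrite (ltW (pim_gt0 _))//; lia.
have := poincare B (ehit k); rewrite energy_ehit// -/F -/S => P.
have Pk0 : 0 <= Pi k by rewrite cdf_ge0//; lia.
have Pk1 : Pi k <= 1 by rewrite cdf_le1//; lia.
have [->|Fn0] := eqVneq F 0; first by rewrite mul0r mulr_ge0// ltW// relax_gt0.
have Fp : 0 < F by rewrite lt_def Fn0.
rewrite -(ler_pM2l Fp).
have h1 : F ^+ 2 * (1 - Pi k) <= Pi k * (S * (1 - Pi k)).
  by rewrite mulrA ler_wpM2r ?subr_ge0.
have h2 : Pi k * (S * (1 - Pi k)) <= Pi k * (rel * F).
  by rewrite ler_wpM2l//; nra.
by have := le_trans h1 h2; rewrite expr2; congr (_ <= _); ring.
Qed.

(** * Positivity, monotonicity and the density of the chain started at 0 *)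

Lemma mean_cut k f : (k <= N.+1)%N -> (forall x, (k <= x)%N -> f x = 0) ->
  E f = \sum_(0 <= y < k) p y * f y.
Proof.
move=> kN f0; rewrite /mean (sum_nat_split _ (leq0n k) kN).
by rewrite [X in _ + X]sum_nat_eq0 ?addr0// => y /andP[ky _]; rewrite f0// mulr0.
Qed.

Lemma mean_ge0 f : (forall x, (x <= N)%N -> 0 <= f x) -> 0 <= E f.
Proof.
by move=> f0; apply: sum_nat_ge0 => x /andP[_ xN]; rewrite mulr_ge0 ?f0// ltW// pim_gt0.
Qed.

Lemma evolve_le t x f g : 0 <= t -> (x <= N)%N ->
  (forall y, (y <= N)%N -> f y <= g y) -> H t f x <= H t g x.
Proof.
move=> t0 xN fg; apply: le_sum_nat => y /andP[_ yN].
by rewrite ler_wpM2l ?fg// ker_ge0.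
Qed.

Lemma evolve_ge0 t x f : 0 <= t -> (x <= N)%N ->
  (forall y, (y <= N)%N -> 0 <= f y) -> 0 <= H t f x.
Proof.
move=> t0 xN f0; apply: sum_nat_ge0 => y /andP[_ yN].
by rewrite mulr_ge0 ?f0// ker_ge0.
Qed.

Lemma evolveD t x f g : H t (fun y => f y + g y) x = H t f x + H t g x.
Proof. by rewrite /evolve -big_split/=; apply: eq_bigr => y _; rewrite mulrDr. Qed.

Lemma evolveZ t x a f : H t (fun y => a * f y) x = a * H t f x.
Proof. by rewrite /evolve mulr_sumr; apply: eq_bigr => y _; rewrite mulrCA. Qed.

Lemma evolve_cst t x a : 0 <= t -> (x <= N)%N -> H t (fun=> a) x = a.
Proof. by move=> t0 xN; rewrite /evolve -mulr_suml ker_sum1// mul1r. Qed.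

Lemma evolve0 f x : (x <= N)%N -> H 0 f x = f x.
Proof.
move=> xN; rewrite /evolve (sum_nat_split _ (leq0n x)); last by lia.
rewrite [X in _ + X]big_ltn// ker_0// eqxx mul1r !sum_nat_eq0 ?addr0 ?add0r//.
  by move=> y /andP[xy yN]; rewrite ker_0// (ltn_eqF xy) mul0r.
by move=> y /andP[_ yx]; rewrite ker_0 ?(gtn_eqF yx) ?mul0r//; lia.
Qed.

Lemma evolve_sqr_le t x f : 0 <= t -> (x <= N)%N ->
  H t f x ^+ 2 <= H t (fun y => f y ^+ 2) x.
Proof.
move=> t0 xN; rewrite -[leRHS]mul1r -(ker_sum1 t0 xN).
by apply: weighted_cauchy_schwarz => y /andP[_ yN]; rewrite ker_ge0.
Qed.

Definition below k : nat -> R := fun y => (y < k)%:R.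

Lemma below_noninc k x : below k x.+1 <= below k x.
Proof. by rewrite /below ler_nat; case: ltnP; case: ltnP => //; lia. Qed.

Lemma evolve_noninc t f x y : 0 <= t -> (forall x, (x < N)%N -> f x.+1 <= f x) ->
  (x <= y)%N -> (y <= N)%N -> H t f y <= H t f x.
Proof.
move=> t0 fle; elim: y => [|y IH]; first by rewrite leqn0 => /eqP ->.
rewrite leq_eqVlt => /predU1P[-> //|xy] yN.
by rewrite (le_trans (ker_mono t0 fle yN))// IH//; lia.
Qed.

(** By reversibility [ker t 0 z / p z = ker t z 0 / p 0], and [z |-> ker t z 0] is the evolution of
    the nonincreasing indicator of {0}. *)
Lemma ker_density_noninc t x y : 0 <= t -> (x <= y)%N -> (y <= N)%N ->
  ker B t 0 y / p y <= ker B t 0 x / p x.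
Proof.
move=> t0 xy yN.
have toH z : (z <= N)%N -> ker B t 0 z / p z = H t (below 1) z / p 0.
  move=> zN; have pz := pim_gt0 zN; have p0 := @pim_gt0 _ B 0 isT.
  have -> : H t (below 1) z = ker B t z 0.
    rewrite /evolve big_ltn// mulr1 sum_nat_eq0 ?addr0// => w /andP[w0 _].
    by rewrite /below (_ : w < 1 = false)%N ?mulr0//; lia.
  have := @ker_rev _ B t 0 z isT zN => e.
  have -> : ker B t z 0 = p 0 * ker B t 0 z / p z.
    by rewrite e mulrAC divff ?mul1r// gt_eqF.
  by field; rewrite !gt_eqF.
rewrite !toH//; last by lia.
by rewrite ler_wpM2r ?invr_ge0 ?(ltW (pim_gt0 _))// evolve_noninc// => *; exact: below_noninc.
Qed.

(** On [0, y] the density is at least its value at [y], while its integral there is at most 1. At a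
    median the density is thus at most 2. *)
Lemma ker_density_le t y : 0 <= t -> (y <= N)%N ->
  ker B t 0 y / p y * Pi y.+1 <= 1.
Proof.
move=> t0 yN; rewrite mulr_sumr -(ker_sum1 t0 (leq0n N)).
rewrite [leRHS](sum_nat_split _ (leq0n y.+1))//.
apply: ler_wpDr.
  by apply: sum_nat_ge0 => x /andP[_ xN]; rewrite ker_ge0.
apply: le_sum_nat => x /andP[_ xy].
have xN : (x <= N)%N by lia.
by rewrite -ler_pdivlMr ?pim_gt0// ker_density_noninc//; lia.
Qed.

(* Second moment and variance of the hitting time of [m]. *)
Definition ehit2 m : nat -> R := hit m (fun y => 2 * ehit m y).

Lemma ehit20 m x : (m <= x)%N -> ehit2 m x = 0. Proof. exact: hit0. Qed.

Definition vhit m x : R := ehit2 m x - ehit m x ^+ 2.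

Lemma ehit_noninc m x y : (m <= N)%N -> (x <= y)%N -> ehit m y <= ehit m x.
Proof.
move=> mN xy; have [ym|my] := leqP y m; last first.
  by rewrite [leLHS]ehit0 ?ehit_ge0// ltnW.
by rewrite (ehit_cat xy ym) lerDr ehit_ge0//; lia.
Qed.

(** The added term is the variance of the passage time from [x] to [x.+1]; variances add up over
    successive edges. *)
Lemma vhitS m x : (x < m)%N -> vhit m x = vhit m x.+1 +
  (2 * (\sum_(0 <= y < x.+1) p y * ehit m y) -
   Pi x.+1 * (ehit m x + ehit m x.+1)) / c x.
Proof.
move=> xm; rewrite /vhit [ehit2 m x]hitS// (ehitS xm).
under eq_bigr => y _ do rewrite mulrCA.
rewrite -mulr_sumr -/(ehit2 m); ring.
Qed.

(** Each edge contributes a nonnegative amount: [ehit m] is nonincreasing, so its average over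
    [0, x] dominates both values occurring in [vhitS]. *)
Lemma vhit_ge0 m x : (m <= N)%N -> 0 <= vhit m x.
Proof.
move=> mN; have [mx|/ltnW xm] := leqP m x.
  by rewrite /vhit ehit20// ehit0// expr0n subrr.
rewrite -(subKn xm); elim: (m - x)%N {xm} => {x} [|d IH].
  by rewrite subn0 /vhit ehit20// ehit0// expr0n subrr.
have [md|dm] := leqP m d.
  by rewrite (_ : m - d.+1 = m - d)%N//; lia.
set x := (m - d.+1)%N in IH *; have xm : (x < m)%N by rewrite /x; lia.
rewrite vhitS// addr_ge0//; first by rewrite (_ : x.+1 = m - d)%N//; rewrite /x; lia.
rewrite divr_ge0 ?(ltW (cond_gt0 _))//; last by lia.
have : Pi x.+1 * ehit m x <= \sum_(0 <= y < x.+1) p y * ehit m y.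
  rewrite mulr_suml; apply: le_sum_nat => y /andP[_ yx].
  by rewrite ler_wpM2l ?ehit_noninc ?(ltW (pim_gt0 _))//; lia.
have : Pi x.+1 * ehit m x.+1 <= Pi x.+1 * ehit m x.
  by rewrite ler_wpM2l ?cdf_ge0 ?ehit_noninc//; lia.
lra.
Qed.

(** * Variance of the hitting time of a median *)

Section Median.
Variable m : nat.
Hypotheses (mN : (m <= N)%N) (Pm : Pi m <= 2^-1) (PmS : 2^-1 <= Pi m.+1).
Local Notation u := (ehit m).
Local Notation a := (ehit m 0%N).

(** Edge by edge. In [vhitS] the increment is at most [2 * E (ehit x.+1) / c x], and [mean_ehit_le]
    with [1 - Pi x.+1 >= 1/2] bounds this by [4 * rel * (Pi x.+1 / c x)], which is [4 * rel] times
    the increment of [u]. *)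
Lemma vhit_le x : vhit m x <= 4 * rel * u x.
Proof.
have r0 := relax_gt0 B.
have [mx|/ltnW xm] := leqP m x.
  by rewrite /vhit ehit20// ehit0// expr0n subrr mulr0.
rewrite -(subKn xm); elim: (m - x)%N {xm} => {x} [|d IH].
  by rewrite subn0 /vhit ehit20// ehit0// expr0n subrr mulr0.
have [md|dm] := leqP m d.
  by rewrite (_ : m - d.+1 = m - d)%N//; lia.
set x := (m - d.+1)%N in IH *; have xm : (x < m)%N by rewrite /x; lia.
move: IH; rewrite (_ : m - d = x.+1)%N; last by rewrite /x; lia.
move=> IH; rewrite vhitS//.
have -> : 4 * rel * u x = 4 * rel * u x.+1 + 4 * rel * (Pi x.+1 / c x).
  by rewrite [u x]ehitS//; ring.
rewrite lerD//.
have cx : 0 < c x by rewrite cond_gt0//; lia.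
rewrite mulrA ler_pM2r ?invr_gt0//.
have e : \sum_(0 <= y < x.+1) p y * u y = E (ehit x.+1) + Pi x.+1 * u x.+1.
  rewrite (@mean_cut x.+1); [|by lia|by move=> y xy; rewrite ehit0].
  rewrite mulr_suml -big_split/=; apply: eq_big_nat => y /andP[_ yx].
  by rewrite -mulrDr -ehit_cat//; lia.
have xN : (x.+1 <= N)%N by lia.
have P1 : Pi x.+1 <= 2^-1 by rewrite (le_trans _ Pm)// le_cdf//; lia.
have P0 : 0 < Pi x.+1 by rewrite cdf_gt0//; lia.
have := mean_ehit_le xN.
have E0 : 0 <= E (ehit x.+1) by apply: mean_ge0 => *; apply: ehit_ge0.
have u1 : u x.+1 <= u x by rewrite ehit_noninc.
rewrite e => le1.
have : E (ehit x.+1) <= 2 * (rel * Pi x.+1) by nra.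
have : Pi x.+1 * u x.+1 <= Pi x.+1 * u x by rewrite ler_pM2l.
lra.
Qed.

Lemma mean_u : E u <= rel.
Proof.
have := mean_ehit_le mN; have r0 := relax_gt0 B.
have E0 : 0 <= E u by apply: mean_ge0 => *; apply: ehit_ge0.
have h1 : 0 <= E u * (2^-1 - Pi m) by rewrite mulr_ge0// subr_ge0.
have h2 : 0 <= rel * (2^-1 - Pi m) by rewrite mulr_ge0 ?subr_ge0// ltW.
lra.
Qed.

(* [w + 2 (t - a) u + (t - a)^2] is the conditional expectation of
   [(tau - a)^2] before the hitting time [tau] of [m]. *)
Lemma evolve_hit_sqr (t : R) : 0 <= t <= a ->
  H t (fun y => (u y + t - a) ^+ 2) 0 <= 8 * rel * a.
Proof.
move=> /andP[t0 ta].
have r0 := relax_gt0 B.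
pose w := ehit2 m.
pose F (s : R) := H s w 0 + 2 * (s - a) * H s u 0 + (s - a) ^+ 2.
pose dF (s : R) := H s (L w) 0 + (2 * H s u 0 + 2 * (s - a) * H s (L u) 0)
  + 2 * (s - a).
have dFx s : is_derive s (1 : R) F (dF s).
  have d1 := ker_derive w s (leq0n N); have d2 := ker_derive u s (leq0n N).
  rewrite /F /dF.
  apply: is_derive_eq.
  rewrite !(scaler0, scaler1, subr0, addr0, add0r) /GRing.scale/=; ring.
(* Below [m] the terms cancel, as [L w = - 2 u] and [L u = - 1]; above [m] there remains
   [2 (s - a) <= 0]. At [m] the flux [2 * E u / p m <= 2 * rel / p m] is reached with probability at
   most [2 * p m]. *)
have dFle s : 0 <= s <= a -> dF s <= 4 * rel.
  move=> /andP[s0 sa].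
  have -> : dF s = H s (fun y => L w y + 2 * u y + 2 * (s - a) * (L u y + 1)) 0.
    rewrite /dF !evolveD !evolveZ evolveD evolve_cst//; ring.
  have pm := pim_gt0 mN.
  apply: (@le_trans _ _ (ker B s 0 m * (2 * rel / p m))); last first.
    have := ker_density_le s0 mN.
    have : 0 <= ker B s 0 m / p m by rewrite divr_ge0 ?ker_ge0 ?(ltW pm).
    have -> : ker B s 0 m * (2 * rel / p m) = 2 * (ker B s 0 m / p m) * rel.
      by ring.
    move=> d0 d1; rewrite (_ : 4 = 2 * 2); last by ring.
    rewrite ler_pM2r// -[leRHS]mulr1 -mulrA ler_pM2l//.
    have := ler_wpM2l d0 PmS; lra.
  rewrite /evolve (sum_nat_split _ (leq0n m)); last by lia.
  rewrite [X in _ + X]big_ltn// sum_nat_eq0 ?add0r; last first.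
    move=> y /andP[_ ym].
    rewrite /w gen_hit_below// gen_hit_below//; ring.
  rewrite -[leRHS]addr0 lerD//.
    rewrite ler_wpM2l ?ker_ge0// /w gen_hit_at//.
    rewrite [X in 2 * X]ehit0// mulr0 addr0.
    have -> : \sum_(0 <= y < m) p y * (2 * u y) = 2 * E u.
      rewrite (@mean_cut m); [|by lia|by move=> y my; rewrite ehit0].
      by rewrite mulr_sumr; apply: eq_bigr => y _; rewrite mulrCA.
    have : 2 * (s - a) * (L u m + 1) <= 0.
      rewrite gen_hit_at// mulr_le0_ge0//; first by lra.
      rewrite addr_ge0// divr_ge0//; last exact: ltW.
      by apply: sum_nat_ge0 => y /andP[_ ym]; rewrite mulr1 ltW// pim_gt0//; lia.
    have : 2 * E u / p m <= 2 * rel / p m.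
      by rewrite ler_pM2r ?invr_gt0// ler_pM2l// mean_u.
    lra.
  rewrite -oppr_ge0 -sumrN; apply: sum_nat_ge0 => y /andP[my yN].
  rewrite -mulrN mulr_ge0 ?ker_ge0// /w gen_hit_above// gen_hit_above// ehit0; last by lia.
  lra.
(* At time 0 the value is [w 0 - a ^+ 2], the variance [vhit m 0]. *)
have F0 : F 0 <= 4 * rel * a.
  rewrite /F !evolve0// sub0r; have := vhit_le 0; rewrite /vhit -/w; lra.
have Ft : F t <= F 0 + 4 * rel * t.
  have := @le_derive_bound R F dF 0 t (4 * rel) t0 dFx; rewrite subr0; apply.
  by move=> x /andP[x0 xt]; apply: dFle; rewrite x0 (le_trans xt).
have a0 : 0 <= a by apply: ehit_ge0.
(* Since [u ^+ 2 <= w] by [vhit_ge0], the integrand of [F t] dominates the square. *)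
have le1 : H t (fun y => (u y + t - a) ^+ 2) 0 <= F t.
  have -> : F t = H t (fun y => w y + 2 * (t - a) * u y + (t - a) ^+ 2) 0.
    by rewrite /F !evolveD evolveZ evolve_cst.
  apply: evolve_le => // y yN; have := vhit_ge0 y mN; rewrite /vhit -/w; nra.
nra.
Qed.

End Median.

(** * Total variation distance from the left end, before and after the mean hitting time *)

Definition tv t x : R := 2^-1 * \sum_(0 <= y < N.+1) `|ker B t x y - p y|.

Lemma tv_ge0 t x : 0 <= tv t x.
Proof. by rewrite mulr_ge0 ?invr_ge0// sum_nat_ge0. Qed.

(** Both measures have mass 1, so the distance is the total of the positive parts of [p - ker]; a
    test function with values in [0, 1] collects at most that. *)
Lemma tv_ge t x g : 0 <= t -> (x <= N)%N -> (forall y, 0 <= g y <= 1) ->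
  E g - H t g x <= tv t x.
Proof.
move=> t0 xN g01.
have -> : tv t x = \sum_(0 <= y < N.+1)
    2^-1 * (`|ker B t x y - p y| + (p y - ker B t x y)).
  by rewrite -mulr_sumr big_split/= sumrB pim_sum1 ker_sum1// subrr addr0.
rewrite /mean /evolve -sumrB; apply: le_sum_nat => y _.
rewrite -mulrBl distrC; have /andP[g0 g1] := g01 y.
set v := p y - _; have [v0|v0] := leP 0 v.
  by rewrite ger0_norm//; nra.
by rewrite ltr0_norm// addNr mulr0; nra.
Qed.

Lemma evolve_add s t f x : (x <= N)%N ->
  H (s + t) f x = H s (fun z => H t f z) x.
Proof.
move=> xN; rewrite /evolve.
under [RHS]eq_bigr => z _ do rewrite mulr_sumr.
rewrite exchange_big_nat/=; apply: eq_big_nat => y /andP[_ yN].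
by rewrite ker_add// mulr_suml; apply: eq_bigr => z _; rewrite mulrA.
Qed.

(** [H s f] is again nonincreasing, hence largest at 0, and averaging it over the position at time
    [t - s] can only lower that value. *)
Lemma evolve_time_noninc (s t : R) f : 0 <= s <= t ->
  (forall x, (x < N)%N -> f x.+1 <= f x) -> H t f 0 <= H s f 0.
Proof.
move=> /andP[s0 st] fle; rewrite -[t](subrK s) evolve_add//.
rewrite -[leRHS](@evolve_cst (t - s) 0)// ?subr_ge0//.
by apply: evolve_le; rewrite ?subr_ge0// => y yN; apply: evolve_noninc.
Qed.

Lemma evolve_below (t : R) k x : (k <= N.+1)%N ->
  H t (below k) x = \sum_(0 <= y < k) ker B t x y.
Proof.
move=> kN; rewrite /evolve (sum_nat_split _ (leq0n k) kN).
rewrite [X in _ + X]sum_nat_eq0 ?addr0.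
  by apply: eq_big_nat => y /andP[_ yk]; rewrite /below yk mulr1.
by move=> y /andP[ky _]; rewrite /below ltnNge ky mulr0.
Qed.

Section Side.
Variable m : nat.
Hypotheses (mN : (m <= N)%N) (Pm : Pi m <= 2^-1) (PmS : 2^-1 <= Pi m.+1).
Local Notation u := (ehit m).
Local Notation a := (ehit m 0%N).

(** The test set is [u <= b]. Markov's inequality with [E u <= rel] makes it large for the
    stationary law; on it [u + t - a <= - D], so Chebyshev's inequality makes it small for the
    chain. *)
Lemma tv_before (t b D : R) : 0 < b -> 0 < D -> 0 <= t <= a - b - D ->
  1 - rel / b - 8 * rel * a / D ^+ 2 <= tv t 0.
Proof.
move=> b0 D0 /andP[t0 ta].
pose g y : R := (u y <= b)%R%:R.
have g01 y : 0 <= g y <= 1 by rewrite /g; case: (u y <= b); rewrite ler01 lexx.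
apply: le_trans (tv_ge t0 (leq0n N) g01).
have r0 := relax_gt0 B.
have leE : 1 - rel / b <= E g.
  have : 1 - E u / b <= E g.
    rewrite -(pim_sum1 B) [E u / b]mulr_suml -sumrB.
    apply: le_sum_nat => y /andP[_ yN]; rewrite -mulrA -[X in X - _]mulr1 -mulrBr.
    have py := pim_gt0 yN; rewrite ler_pM2l// /g lerBlDr.
    have uy : 0 <= u y / b by rewrite divr_ge0 ?ehit_ge0// ltW.
    case: (leP (u y) b) => [ub|/ltW bu]; first by rewrite lerDl.
    by rewrite add0r ler_pdivlMr// mul1r.
  have : E u / b <= rel / b by rewrite ler_pM2r ?invr_gt0// mean_u.
  lra.
have leH : H t g 0 <= 8 * rel * a / D ^+ 2.
  have tta : 0 <= t <= a by rewrite t0/=; lra.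
  have le8 := evolve_hit_sqr mN Pm PmS tta.
  rewrite ler_pdivlMr ?exprn_gt0// [leLHS]mulrC -evolveZ.
  apply: le_trans le8; apply: evolve_le => // y yN.
  rewrite /g; case: (leP (u y) b) => [ub|_]; last by rewrite mulr0 sqr_ge0.
  rewrite mulr1 -[leRHS]sqrrN ler_pXn2r ?nnegrE//; lra.
lra.
Qed.

(** States below [m] contribute minus their probability; the flux at [m] contributes [Pi m] times
    the density there. The part of [Pi m] carried by [k, m) is paid for by the probability of [k,
    m), where the density is larger, and the rest costs at most [2 * Pi k]. *)
Lemma evolve_gen_ehit_le (s : R) k : 0 <= s -> (k <= m)%N ->
  H s (L u) 0 <= - (H s (below k) 0 - 2 * Pi k).
Proof.
move=> s0 km; have pm := pim_gt0 mN.
have mN1 := leqW mN; have kN1 := leq_trans km mN1.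
have g0 : 0 <= ker B s 0 m / p m by rewrite divr_ge0 ?ker_ge0 ?(ltW pm).
have g2 : ker B s 0 m / p m <= 2.
  have := ker_density_le s0 mN; have := ler_wpM2l g0 PmS; lra.
rewrite evolve_below//.
rewrite /evolve (sum_nat_split _ (leq0n m) mN1).
rewrite [X in _ + X]big_ltn// [X in _ + (_ + X)]sum_nat_eq0 ?addr0; last first.
  by move=> y /andP[my _]; rewrite gen_hit_above// mulr0.
rewrite gen_hit_at//.
rewrite (eq_big_nat _ _ (F2 := fun y => - ker B s 0 y)); last first.
  by move=> y /andP[_ ym]; rewrite gen_hit_below// mulrN1.
rewrite sumrN [X in _ * (X / _)](eq_bigr p) => [|y _]; last by rewrite mulr1.
rewrite -/(cdf m) (sum_nat_split _ (leq0n k) km) -[_ * (_ / _)]mulrCA.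
have : ker B s 0 m / p m * \sum_(k <= y < m) p y <=
    \sum_(k <= y < m) ker B s 0 y.
  rewrite mulr_sumr; apply: le_sum_nat => y /andP[ky ym].
  have yN : (y <= N)%N by exact: leq_trans (ltnW ym) mN.
  by rewrite -ler_pdivlMr ?pim_gt0// ker_density_noninc// ltnW.
have : Pi m = Pi k + \sum_(k <= y < m) p y by exact: sum_nat_split.
have Pk0 : 0 <= Pi k by exact: cdf_ge0.
move=> ->; have := ler_wpM2r Pk0 g2; lra.
Qed.

(** If the bound failed at [t], by [evolve_time_noninc] it would fail during all of [a, t]. The mean
    of [u], at most [sqrt (8 * rel * a)] at time [a], would then fall faster than [d] and become
    negative. *)
Lemma evolve_below_after (t d : R) k : (k <= m)%N -> 0 < d -> a < t ->
  Num.sqrt (8 * rel * a) <= d * (t - a) ->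
  H t (below k) 0 <= 2 * Pi k + d.
Proof.
move=> km d0 at_ sqle; rewrite leNgt; apply/negP => lt_H.
have a0 : 0 <= a by apply: ehit_ge0.
have r0 := relax_gt0 B.
pose M (s : R) := H s u 0; pose d' := H t (below k) 0 - 2 * Pi k.
have dd' : d < d' by rewrite /d'; lra.
have : M t <= M a + - d' * (t - a).
  apply: (@le_derive_bound _ M (fun s => H s (L u) 0)) => [|s|s /andP[as_ st]].
  - exact: ltW.
  - exact: ker_derive.
  - apply: le_trans (evolve_gen_ehit_le _ km) _; first by lra.
    rewrite lerN2 /d' lerD2r evolve_time_noninc//.
      by rewrite st andbT; lra.
    by move=> *; apply: below_noninc.
have M0 s : 0 <= s -> 0 <= M s.
  by move=> s0; apply: evolve_ge0 => // y yN; exact: ehit_ge0.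
have Mt : 0 <= M t by apply: M0; lra.
have Ma : M a <= Num.sqrt (8 * rel * a).
  rewrite -(@ler_pXn2r _ 2)// ?nnegrE ?sqrtr_ge0 ?M0//.
  rewrite sqr_sqrtr ?mulr_ge0// ?(ltW r0)//.
  apply: le_trans (evolve_sqr_le _ _ _) _ => //.
  have aa : 0 <= a <= a by rewrite a0 lexx.
  have := evolve_hit_sqr mN Pm PmS aa.
  congr (_ <= _); apply: eq_bigr => y _; congr (_ * _ ^+ 2); ring.
have : 0 < (d' - d) * (t - a) by rewrite mulr_gt0 ?subr_gt0.
lra.
Qed.

End Side.

(** * Resistance and mixing from the bulk *)

Lemma energy_sub_le f i j : (i <= j)%N -> (j <= N)%N ->
  \sum_(i <= x < j) c x * (f x.+1 - f x) ^+ 2 <= energy N c f.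
Proof.
move=> ij jN; rewrite /energy (sum_nat_split _ (leq0n i)) ?(leq_trans ij)//.
rewrite [X in _ <= _ + X](sum_nat_split _ ij)// addrCA lerDl addr_ge0//;
  apply: sum_nat_ge0 => x /andP[? ?];
  by rewrite mulr_ge0 ?sqr_ge0// ltW// cond_gt0//; lia.
Qed.

(** Effective resistance between [i] and [j]. *)
Definition res i j : R := \sum_(i <= x < j) (c x)^-1.

(* Poincare inequality for the function that is constant on [0, i] and on
   [j, N], and harmonic in between. *)
Lemma res_le i j : (i <= j)%N -> (j <= N)%N ->
  Pi i.+1 * (1 - Pi j) * res i j <= rel.
Proof.
have r0 := relax_gt0 B.
rewrite leq_eqVlt => /predU1P[-> _|lt_ij jN].
  by rewrite /res big_geq// mulr0 ltW.
have ij := ltnW lt_ij.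
have c0 x : (i <= x < j)%N -> 0 < c x by move=> /andP[_ xj]; rewrite cond_gt0//; lia.
set Rs := res i j.
have Rs0 : 0 <= Rs by apply: sum_nat_ge0 => x /c0; rewrite invr_ge0 => /ltW.
pose f x := res (maxn i x) j.
have fi x : (x <= i)%N -> f x = Rs by move=> xi; rewrite /f (maxn_idPl xi).
have fj x : (j <= x)%N -> f x = 0.
  by move=> jx; rewrite /f /res big_geq// (leq_trans jx)// leq_maxr.
have en : energy N c f = Rs.
  rewrite /energy (sum_nat_split _ (leq0n i)) ?(leq_trans ij)//.
  rewrite sum_nat_eq0 ?add0r; last first.
    by move=> x /andP[_ xi]; rewrite !fi ?subrr ?expr0n ?mulr0// ltnW.
  rewrite (sum_nat_split _ ij jN) [X in _ + X]sum_nat_eq0 ?addr0; last first.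
    by move=> x /andP[jx _]; rewrite !fj ?subrr ?expr0n ?mulr0// leqW.
  apply: eq_big_nat => x xij; have cx := c0 _ xij; case/andP: xij => ix xj.
  rewrite /f !(maxn_idPr _) ?(leqW ix)// [res x j]/res big_ltn// -/(res x.+1 j).
  by field; rewrite gt_eqF.
have := poincare B f; rewrite en.
set mu := E f.
have -> : E (fun x => f x ^+ 2) - mu ^+ 2 = E (fun x => (f x - mu) ^+ 2).
  rewrite [RHS](eq_bigr (fun x => p x * f x ^+ 2 - 2 * mu * (p x * f x) + mu ^+ 2 * p x)) => [|x _].
    rewrite big_split/= sumrB -!mulr_sumr pim_sum1 -/(mean N p f) -/mu /mean; ring.
  ring.
move=> le1.
have : Pi i.+1 * (Rs - mu) ^+ 2 + (1 - Pi j) * mu ^+ 2 <=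
    E (fun x => (f x - mu) ^+ 2).
  have jN1 : (j <= N.+1)%N by lia.
  have -> : 1 - Pi j = \sum_(j <= x < N.+1) p x.
    by rewrite -(pim_sum1 B) (sum_nat_split _ (leq0n j) jN1) addrC addKr.
  rewrite /mean (sum_nat_split _ (leq0n j) jN1) (sum_nat_split _ (leq0n i.+1) lt_ij).
  rewrite -[leLHS]addr0 addrAC !lerD//.
  - by rewrite mulr_suml; apply: le_sum_nat => x /andP[_ xi]; rewrite fi.
  - apply: sum_nat_ge0 => x /andP[_ xj].
    by rewrite mulr_ge0 ?sqr_ge0// ltW// pim_gt0//; lia.
  - by rewrite mulr_suml; apply: le_sum_nat => x /andP[jx _]; rewrite fj// sub0r sqrrN.
have q0 : 0 < Pi i.+1 by rewrite cdf_gt0//; lia.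
have P1 : 0 <= 1 - Pi j by rewrite subr_ge0 cdf_le1//; lia.
have P2 : Pi i.+1 <= Pi j by rewrite le_cdf//; lia.
move: le1; set b := 1 - Pi j in P1 *; set q := Pi i.+1 in q0 P2 *.
move=> le1 le2; have qb : q + b <= 1 by rewrite /b; lra.
have le3 : q * (Rs - mu) ^+ 2 + b * mu ^+ 2 <= rel * Rs by exact: le_trans le2 le1.
(* Over all [mu], the left side of [le3] is at least [q * b / (q + b) * Rs ^+ 2], and
   [q + b <= 1]. *)
have le4 : q * b * Rs ^+ 2 <= rel * Rs.
  apply: le_trans le3.
  apply: (@le_trans _ _ ((q + b) * (q * (Rs - mu) ^+ 2 + b * mu ^+ 2))).
    rewrite -subr_ge0.
    have -> : (q + b) * (q * (Rs - mu) ^+ 2 + b * mu ^+ 2) - q * b * Rs ^+ 2 =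
      (q * (Rs - mu) - b * mu) ^+ 2 by ring.
    exact: sqr_ge0.
  rewrite -[leRHS]mul1r ler_wpM2r// addr_ge0// mulr_ge0 ?sqr_ge0//; exact: ltW.
have [Re|Rn] := eqVneq Rs 0; first by rewrite Re mulr0 ltW.
have Rp : 0 < Rs by rewrite lt_def Rn.
by rewrite -(ler_pM2r Rp); apply: le_trans le4; rewrite expr2 mulrA.
Qed.

(* Mixing from a starting point in the bulk takes a time of order [rel]. *)
Lemma bulk_sqr_le (e : R) f i j z : 0 < e -> (i <= z)%N -> (z <= j)%N -> (j <= N)%N ->
    e <= Pi i.+1 -> e <= 1 - Pi j -> 2^-1 <= Pi j.+1 - Pi i -> E f = 0 ->
  f z ^+ 2 <= (2 / e ^+ 2 + 4) * rel * energy N c f.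
Proof.
move=> e0 iz zj jN ei ej bulk f0; have r0 := relax_gt0 B.
have En0 := energy_ge0 f (@cond_gt0 _ B).
have ij : (i <= j)%N by lia.
have resij : res i j <= rel / e ^+ 2.
  rewrite ler_pdivlMr ?exprn_gt0//; apply: le_trans (res_le ij jN).
  rewrite mulrC ler_wpM2r//; last by rewrite expr2 ler_pM// ltW.
  by apply: sum_nat_ge0 => x /andP[_ xj]; rewrite invr_ge0 ltW// cond_gt0//; lia.
(* Cauchy-Schwarz along the path: a squared potential difference is at most resistance times
   energy. *)
have osc x y : (i <= x)%N -> (x <= y)%N -> (y <= j)%N ->
    (f y - f x) ^+ 2 <= res i j * energy N c f.
  move=> ix xy yj; rewrite -(telescope_sumr _ xy).
  have c0 w : (x <= w < y)%N -> 0 < c w by move=> ?; rewrite cond_gt0//; lia.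
  rewrite (eq_big_nat _ _ (F2 := fun w => (c w)^-1 * (c w * (f w.+1 - f w)))); last first.
    by move=> w /c0 cw; rewrite mulKf// gt_eqF.
  apply: le_trans (weighted_cauchy_schwarz _ _) _.
    by move=> w /c0 cw; rewrite invr_ge0 ltW.
  apply: ler_pM.
  - by apply: sum_nat_ge0 => w /c0 cw; rewrite invr_ge0 ltW.
  - by apply: sum_nat_ge0 => w /c0 cw; rewrite mulr_ge0 ?sqr_ge0// invr_ge0 ltW.
  - rewrite /res (sum_nat_split _ ix) ?(leq_trans xy)//.
    rewrite [X in _ <= _ + X](sum_nat_split _ xy yj) addrCA lerDl addr_ge0//;
      by apply: sum_nat_ge0 => w ?; rewrite invr_ge0 ltW// cond_gt0//; lia.
  - apply: le_trans (energy_sub_le f xy _); last by lia.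
    rewrite (eq_big_nat _ _ (F2 := fun w => c w * (f w.+1 - f w) ^+ 2))// => w /c0 cw.
    by rewrite expr2 [in RHS]expr2; field; rewrite gt_eqF.
have osc2 y : (i <= y < j.+1)%N -> (f z - f y) ^+ 2 <= res i j * energy N c f.
  move=> /andP[iy yj]; have [zy|/ltnW yz] := leqP z y.
    by rewrite -sqrrN opprB osc.
  exact: osc.
have := poincare B f; rewrite f0 expr0n subr0 => Ef2.
(* The inequality [f z ^+ 2 <= 2 (f z - f x) ^+ 2 + 2 f x ^+ 2] averaged over the bulk; the Poincare
   inequality controls the last term because [f] has mean 0. *)
have key : (Pi j.+1 - Pi i) * f z ^+ 2 <=
    (Pi j.+1 - Pi i) * (2 * (res i j * energy N c f)) + 2 * (rel * energy N c f).
  have -> : Pi j.+1 - Pi i = \sum_(i <= x < j.+1) p x.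
    by rewrite /cdf (sum_nat_split _ (leq0n i) (leqW ij)) addrC addKr.
  apply: (@le_trans _ _ (\sum_(i <= x < j.+1) (p x * (2 * (res i j * energy N c f)) + 2 * (p x * f x ^+ 2)))).
    rewrite mulr_suml; apply: le_sum_nat => x xij.
    have px : 0 < p x by apply: pim_gt0; lia.
    rewrite [2 * (p x * _)]mulrCA -mulrDr ler_pM2l//; have := osc2 _ xij.
    have := sqr_ge0 (f z - 2 * f x); nra.
  rewrite big_split/= -mulr_suml lerD2l -mulr_sumr ler_pM2l//.
  apply: le_trans Ef2.
  rewrite /mean (sum_nat_split _ (leq0n i)); last by lia.
  rewrite [X in _ <= _ + X](@sum_nat_split _ _ j.+1)//; last by lia.
  rewrite addrCA lerDl addr_ge0//; apply: sum_nat_ge0 => x ?;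
    by rewrite mulr_ge0 ?sqr_ge0// ltW// pim_gt0//; lia.
move: bulk key; set b := Pi j.+1 - Pi i; set En := energy N c f in En0 *.
move=> b2 key.
have le1 : res i j * En <= rel / e ^+ 2 * En by rewrite ler_wpM2r.
have rE : 0 <= rel * En by rewrite mulr_ge0// ltW.
have : b * f z ^+ 2 <= b * ((2 / e ^+ 2 + 4) * rel * En).
  apply: le_trans key _.
  have : b * (2 * (res i j * En)) <= b * (2 * (rel / e ^+ 2 * En)).
    by rewrite ler_wpM2l ?ler_pM2l//; lra.
  have : 2^-1 * (rel * En) <= b * (rel * En) by rewrite ler_wpM2r.
  lra.
by rewrite ler_pM2l//; lra.
Qed.

(** The function given by [smoothing] has its energy as value at [z], so [bulk_sqr_le] becomes
    [f z ^+ 2 <= 6 / e ^+ 2 * rel * f z] and bounds [f z] itself. The time makes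
    [f z / (2 * s) <= e ^+ 2], and Cauchy-Schwarz passes from the chi-square to the total variation
    distance. *)
Lemma tv_bulk (e : R) i j z : 0 < e -> e <= 1 -> (i <= z)%N -> (z <= j)%N -> (j <= N)%N ->
    e <= Pi i.+1 -> e <= 1 - Pi j -> 2^-1 <= Pi j.+1 - Pi i ->
  tv (3 * rel / e ^+ 4) z <= e.
Proof.
move=> e0 e1 iz zj jN ei ej bulk; have r0 := relax_gt0 B.
have zN : (z <= N)%N by lia.
have [f [f0 fz smooth]] := smoothing zN.
have := bulk_sqr_le e0 iz zj jN ei ej bulk f0; rewrite -fz => sq.
set s := 3 * rel / e ^+ 4.
have e4 : 0 < e ^+ 4 by rewrite exprn_gt0.
have e2 : 0 < e ^+ 2 by rewrite exprn_gt0.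
have s0 : 0 < s by rewrite /s divr_gt0// mulr_gt0.
have fle : f z <= 6 / e ^+ 2 * rel.
  have f0z : 0 <= f z by rewrite fz; exact: energy_ge0 (@cond_gt0 _ B).
  have [->|fn] := eqVneq (f z) 0; first by rewrite mulr_ge0 ?divr_ge0 ?(ltW r0)// ltW.
  have fp : 0 < f z by rewrite lt_def fn.
  rewrite -(ler_pM2r fp) -expr2; apply: le_trans sq _.
  rewrite ler_pM2r// ler_pM2r//.
  have : 1 <= (e ^+ 2)^-1 by rewrite invf_ge1// expr_le1// ltW.
  lra.
have := smooth s s0.
set q := E _ => qle.
have : tv s z ^+ 2 <= q / 4.
  have tvE : tv s z = 2^-1 * E (fun y => `|ker B s z y / p y - 1|).
    rewrite /tv /mean; congr (_ * _); apply: eq_big_nat => y /andP[_ yN].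
    have py := pim_gt0 yN; rewrite -[X in X * _](gtr0_norm py) -normrM.
    by rewrite mulrBr mulr1 mulrCA divff ?mulr1 ?gt_eqF.
  rewrite tvE exprMn.
  have := @weighted_cauchy_schwarz _ p (fun y => `|ker B s z y / p y - 1|) 0 N.+1.
  rewrite pim_sum1 mul1r => cs.
  have : E (fun y => `|ker B s z y / p y - 1|) ^+ 2 <= q.
    apply: le_trans (cs _) _; first by move=> y /andP[_ yN]; rewrite ltW// pim_gt0.
    by rewrite /q /mean; under eq_bigr => y _ do rewrite real_normK ?num_real//.
  have -> : (2^-1 : R) ^+ 2 = 4^-1 by field.
  by rewrite mulrC ler_pM2r ?invr_gt0.
have : q / 4 <= e ^+ 2.
  have : f z / (2 * s) <= e ^+ 2.
    have s2 : 0 < 2 * s by rewrite mulr_gt0.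
    rewrite ler_pdivrMr//; apply: le_trans fle _.
    rewrite /s (_ : e ^+ 4 = e ^+ 2 * e ^+ 2); last by rewrite -exprD.
    by rewrite le_eqVlt; apply/orP; left; apply/eqP; field; rewrite gt_eqF.
  lra.
move=> h1 h2; have := le_trans h2 h1.
by rewrite ler_pXn2r// nnegrE ?tv_ge0// ltW.
Qed.

End Core.

(** * Reflection of the state space, and gluing of the two ends *)

Section Reversal.
Context {R : realType} (B : bd_flow R).
Local Notation N := (top B).
Local Notation p := (pim B).
Local Notation c := (cond B).
Local Notation h := (ker B).
Local Notation rel := (relax B).
Local Notation E := (mean N p).
Local Notation H := (evolve N h).
Local Notation L := (gen p c).
Local Notation Pi := (cdf B).
Implicit Types (f : nat -> R) (x y k i j : nat).

Lemma sum_nat_rev (n : nat) (F : nat -> R) :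
  \sum_(0 <= y < n.+1) F (n - y)%N = \sum_(0 <= y < n.+1) F y.
Proof. by rewrite big_nat_rev/=; apply: eq_big_nat => y /andP[_ yn]; congr F; lia. Qed.

Definition rpim x : R := p (N - x)%N.
(** The case distinction is needed at [x = N], where truncated subtraction would return [c 0]
    instead of 0. *)
Definition rcond x : R := if (x < N)%N then c (N - x.+1)%N else 0.
Definition rker (t : R) x y : R := ker B t (N - x)%N (N - y)%N.

Lemma mean_rev f : mean N rpim f = E (fun y => f (N - y)%N).
Proof.
rewrite /mean -[RHS]sum_nat_rev; apply: eq_big_nat => y /andP[_ yN].
by rewrite subKn.
Qed.

Lemma evolve_rev t f x :
  evolve N rker t f x = H t (fun y => f (N - y)%N) (N - x)%N.
Proof.
rewrite /evolve -[RHS]sum_nat_rev; apply: eq_big_nat => y /andP[_ yN].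
by rewrite subKn.
Qed.

Lemma energy_rev f : energy N rcond f = energy N c (fun y => f (N - y)%N).
Proof.
rewrite /energy big_nat_rev/=; apply: eq_big_nat => y /andP[_ yN].
rewrite /rcond (_ : (0 + N - y.+1 < N)%N); last by lia.
rewrite (_ : N - (0 + N - y.+1).+1 = y)%N; last by lia.
rewrite (_ : (0 + N - y.+1).+1 = N - y)%N; last by lia.
by rewrite -sqrrN opprB add0n.
Qed.

Lemma gen_rev f y : (y <= N)%N ->
  gen rpim rcond f y = L (fun y => f (N - y)%N) (N - y)%N.
Proof.
move=> yN; rewrite /gen /rpim; congr (_ / _); rewrite addrC; congr (_ + _).
  rewrite /rcond; case: y yN => [|y] yN /=.
    by rewrite subrr mulr0 subn0 cond_top mul0r.
  by rewrite yN subKn// (_ : N - (N - y.+1).+1 = y)%N//; lia.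
rewrite /rcond subKn//; case: ltnP => [ylt|Ny].
  by rewrite subnS (_ : N - (N - y).-1 = y.+1)%N//; lia.
by rewrite (_ : N - y = 0)%N ?subn0 ?mul0r//=; [rewrite (_ : y = N) ?subrr ?mulr0//; lia|lia].
Qed.

(** Kept transparent, so that the fields of the reflected flow compute and left-end results can be
    read as right-end results. *)
Definition rev_flow : bd_flow R.
Proof.
apply: (@BDFlow R N rpim rcond rker rel).
- by move=> x xN; apply: pim_gt0; lia.
- by rewrite sum_nat_rev pim_sum1.
- by move=> x xN; rewrite /rcond xN cond_gt0//; lia.
- by rewrite /rcond ltnn.
- by move=> t x y t0 xN yN; apply: ker_ge0 => //; lia.
- by move=> t x t0 xN; rewrite (sum_nat_rev N (ker B t (N - x)%N)) ker_sum1//; lia.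
- move=> x y xN yN; rewrite /rker ker_0; [|lia|lia].
  by rewrite (_ : (N - x == N - y)%N = (x == y))//; lia.
- move=> s t x y xN yN; rewrite /rker ker_add; [|lia|lia].
  by rewrite (sum_nat_rev N (fun z => ker B s (N - x)%N z * ker B t z (N - y)%N)).
- by move=> t x y xN yN; rewrite /rker /rpim ker_rev//; lia.
(* Reflection turns nonincreasing functions into nondecreasing ones; the factor -1 restores the
   direction. *)
- move=> t f t0 fle x xN; rewrite !evolve_rev.
  have := @ker_mono _ B t (fun y => -1 * f (N - y)%N) t0 _ (N - x.+1)%N.
  rewrite !evolveZ !mulN1r lerN2 (_ : (N - x.+1).+1 = N - x)%N; last by lia.
  apply; last by lia.
  move=> y yN; rewrite !mulN1r lerN2 (_ : N - y = (N - y.+1).+1)%N; last by lia.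
  by apply: fle; lia.
- move=> f t x xN.
  have -> : (fun s : R => evolve N rker s f x) =
      (fun s => H s (fun y => f (N - y)%N) (N - x)%N).
    by apply/funext => s; rewrite evolve_rev.
  have -> : evolve N rker t (gen rpim rcond f) x =
      H t (L (fun y => f (N - y)%N)) (N - x)%N.
    rewrite evolve_rev; apply: eq_big_nat => y /andP[_ yN].
    by rewrite gen_rev ?subKn// leq_subr.
  by apply: ker_derive; rewrite leq_subr.
- exact: relax_gt0.
- by move=> f; rewrite !mean_rev energy_rev; exact: poincare.
- move=> z zN; have [f [f0 fz sm]] := @smoothing _ B (N - z)%N (leq_subr _ _).
  exists (fun y => f (N - y)%N); split.
  + by rewrite mean_rev -f0; apply: eq_big_nat => y /andP[_ yN]; rewrite subKn.
  + rewrite fz energy_rev /energy; apply: eq_big_nat => y /andP[_ yN].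
    by rewrite !subKn// ltnW.
  + move=> s s0; rewrite mean_rev; apply: le_trans (sm s s0).
    rewrite /rker /rpim /mean le_eqVlt; apply/orP; left; apply/eqP.
    by apply: eq_big_nat => y /andP[_ yN]; rewrite !subKn.
Defined.

Lemma cdf_rev k : (k <= N.+1)%N -> cdf rev_flow k = 1 - Pi (N.+1 - k)%N.
Proof.
move=> kN; rewrite -(pim_sum1 B) (sum_nat_split _ (leq0n (N.+1 - k))) ?leq_subr//.
rewrite -/(cdf B _) addrC addKr [LHS]/cdf/= /rpim.
rewrite -[in RHS](add0n (N.+1 - k)%N) big_addn subKn// [RHS]big_nat_rev/=.
by apply: eq_big_nat => y /andP[_ yk]; congr p; lia.
Qed.

Lemma tv_rev t x : tv rev_flow t x = tv B t (N - x)%N.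
Proof.
by rewrite /tv/= /rker /rpim (sum_nat_rev N (fun y => `|ker B t (N - x)%N y - p y|)).
Qed.

Lemma quantile (e : R) : 0 <= e <= 1 ->
  exists2 k, (k <= N)%N & Pi k <= e <= Pi k.+1.
Proof.
move=> /andP[e0 e1].
have ex : exists k, e <= Pi k.+1 by exists N; rewrite cdf_top.
have [k ek kmin] := ex_minnP ex.
exists k; first by apply: kmin; rewrite cdf_top.
rewrite ek andbT; case: k {ek} kmin => [|k] kmin; first by rewrite /cdf big_geq.
by rewrite leNgt; apply/negP => /ltW/kmin; rewrite ltnn.
Qed.

Lemma tv_le1 t x : 0 <= t -> (x <= N)%N -> tv B t x <= 1.
Proof.
move=> t0 xN; rewrite /tv mulrC ler_pdivrMr// mul1r.
apply: (@le_trans _ _ (\sum_(0 <= y < N.+1) (ker B t x y + p y))).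
  apply: le_sum_nat => y /andP[_ yN]; apply: le_trans (ler_normB _ _) _.
  by rewrite !ger0_norm ?ker_ge0// ltW// pim_gt0.
by rewrite big_split/= ker_sum1// pim_sum1.
Qed.

Lemma tv_add s t x : 0 <= t -> (x <= N)%N ->
  tv B (t + s) x <= H t (fun z => tv B s z) x.
Proof.
move=> t0 xN; rewrite /tv evolveZ ler_pM2l//.
have -> : H t (fun z => \sum_(0 <= y < N.+1) `|ker B s z y - p y|) x =
    \sum_(0 <= y < N.+1) \sum_(0 <= z < N.+1) ker B t x z * `|ker B s z y - p y|.
  by rewrite exchange_big_nat/=; apply: eq_bigr => z _; rewrite mulr_sumr.
apply: le_sum_nat => y /andP[_ yN].
have -> : ker B (t + s) x y - p y =
    \sum_(0 <= z < N.+1) ker B t x z * (ker B s z y - p y).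
  rewrite ker_add// (eq_bigr _ (fun z _ => mulrBr _ _ _)) sumrB -mulr_suml.
  by rewrite ker_sum1// mul1r.
apply: le_trans (ler_norm_sum _ _ _) _.
rewrite !big_nat; apply: ler_sum => z zN.
by rewrite normrM ger0_norm// ker_ge0.
Qed.

Lemma evolve_noninc0 t k x : 0 <= t -> (x <= N)%N ->
  H t (below k) x <= H t (below k) 0.
Proof. by move=> t0 xN; apply: evolve_noninc => // *; apply: below_noninc. Qed.

(* The bulk is reached with high probability from both ends, hence, by
   monotonicity, from everywhere. *)
Lemma tv_after_bulk (e t s : R) i j x : 0 <= t -> 0 <= s -> 0 <= e ->
    (x <= N)%N -> (j <= N)%N ->
    H t (below i) 0 <= 3 * e -> evolve N rker t (below (N - j)) 0 <= 3 * e ->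
    (forall z, (i <= z <= j)%N -> tv B s z <= e) ->
  tv B (t + s) x <= 7 * e.
Proof.
move=> t0 s0 e0 xN jN le_i le_j le_s.
apply: le_trans (tv_add _ t0 xN) _.
have li : H t (below i) x <= 3 * e by apply: le_trans le_i; exact: evolve_noninc0.
have lj : H t (fun y => below (N - j) (N - y)%N) x <= 3 * e.
  apply: le_trans le_j; rewrite -{1}[x](subKn xN) -evolve_rev.
  apply: (@evolve_noninc _ rev_flow) => //; last by rewrite leq_subr.
  by move=> *; apply: below_noninc.
(* The distance is at most 1 outside the bulk and at most [e] inside, whence [3 * e + 3 * e + e]. *)
apply: (@le_trans _ _ (H t (fun y => below i y + below (N - j) (N - y)%N + e) x)).
  apply: evolve_le => // y yN; rewrite /below.
  have T1 : (true%:R : R) = 1 by [].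
  have F0 : (false%:R : R) = 0 by [].
  have [yi|iy] := ltnP y i; have [yj|jy] := ltnP (N - y) (N - j);
    rewrite ?T1 ?F0 ?add0r; try by have := tv_le1 s0 yN; lra.
  by rewrite le_s//; lia.
rewrite !evolveD evolve_cst//; lra.
Qed.

End Reversal.

(** * Two-sided mixing profile *)

Section Profile.
Context {R : realType} (B : bd_flow R).
Local Notation N := (top B).
Local Notation rel := (relax B).
Implicit Type x : nat.

Local Notation rB := (rev_flow B).

(** [A] is the larger of the mean hitting times of a median from 0 and from [N]. The upper bound has
    to wait for both ends; the lower bound starts from the slower one. *)
Theorem tv_profile : exists2 A : R, 0 <= A &
  (forall e t x, 0 < e <= 4^-1 ->
     A + (Num.sqrt (8 * rel * A) / e + rel + 3 * rel / e ^+ 4) <= t ->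
     (x <= N)%N -> tv B t x <= 7 * e) /\
  (forall b D t : R, 0 < b -> 0 < D -> 0 <= t <= A - b - D ->
     exists2 x, (x <= N)%N & 1 - rel / b - 8 * rel * A / D ^+ 2 <= tv B t x).
Proof.
have half : 0 <= (2^-1 : R) <= 1 by apply/andP; split; lra.
have [m mN /andP[Pm PmS]] := quantile B half.
have [m' mN' /andP[Pm' PmS']] := quantile rB half.
have r0 := relax_gt0 B.
set a := ehit B m 0; set a' := ehit rB m' 0.
have a0 : 0 <= a by apply: ehit_ge0.
have a0' : 0 <= a' by apply: ehit_ge0.
have le_aA : a <= Num.max a a' by rewrite le_max lexx.
have le_aA' : a' <= Num.max a a' by rewrite le_max lexx orbT.
exists (Num.max a a'); first exact: le_trans le_aA.
split=> [e t x /andP[e0 e4] le_t xN|b D t b0 D0 le_t]; last first.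
  have [aa|aa] := leP a a'.
    rewrite (max_idPr aa) in le_t *.
    exists N => //; have := tv_before mN' Pm' PmS' b0 D0 le_t.
    by rewrite tv_rev subn0.
  rewrite (max_idPl (ltW aa)) in le_t *.
  by exists 0%N => //; apply: (tv_before mN Pm PmS b0 D0 le_t).
set A := Num.max a a' in le_aA le_aA' le_t.
set s := 3 * rel / e ^+ 4 in le_t.
have s0 : 0 < s by rewrite divr_gt0 ?exprn_gt0// mulr_gt0.
have e01 : 0 <= e <= 1 by apply/andP; split; lra.
have [i iN /andP[Pi_e ePi]] := quantile B e01.
have [i' iN' /andP[Pi_e' ePi']] := quantile rB e01.
have A0 : 0 <= A by exact: le_trans le_aA.
have sq0 := sqrtr_ge0 (8 * rel * A).
have sqe : 0 <= Num.sqrt (8 * rel * A) / e by rewrite divr_ge0// ltW.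
(* The summand [rel] in the waiting time makes this strict even when [A = 0]. *)
have lt1 : A < t - s by lra.
have sq_le b : 0 <= b -> b <= A -> Num.sqrt (8 * rel * b) <= e * (t - s - b).
  move=> b0 bA; apply: (@le_trans _ _ (Num.sqrt (8 * rel * A))).
    by rewrite ler_wsqrtr// ler_pM2l// mulr_gt0.
  rewrite [leRHS]mulrC -ler_pdivrMr//; lra.
have im : (i <= m)%N.
  rewrite leqNgt; apply/negP => mi.
  have : cdf B m.+1 <= cdf B i by rewrite le_cdf// leqW.
  lra.
have im' : (i' <= m')%N.
  rewrite leqNgt; apply/negP => mi.
  have : cdf rB m'.+1 <= cdf rB i' by rewrite le_cdf// leqW.
  lra.
have iN2 : (i' <= N)%N := iN'.
rewrite (cdf_rev (k := i'.+1))// subSS in ePi'.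
rewrite (cdf_rev (leqW iN2)) subSn// in Pi_e'.
(* The bulk is [i, N - i'], between the two [e]-quantiles; its mass is at least [1 - 2 * e >= 1/2].
   Each end is left up to probability [2 * e + e]. *)
rewrite -[t](subrK s); apply: (@tv_after_bulk _ B e (t - s) s i (N - i')%N) => //;
  try lra; first exact: leq_subr.
- apply: le_trans (evolve_below_after mN Pm PmS im e0 _ (sq_le _ a0 le_aA)) _.
    exact: le_lt_trans lt1.
  lra.
- rewrite subKn//.
  apply: le_trans (evolve_below_after mN' Pm' PmS' im' e0 _ (sq_le _ a0' le_aA')) _.
    exact: le_lt_trans lt1.
  by rewrite (cdf_rev (leqW iN2)) subSn//; lra.
- move=> z /andP[iz zj]; apply: (tv_bulk e0 _ iz zj (leq_subr _ _) ePi ePi'); lra.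
Qed.

End Profile.

(** * Semigroups given by their spectral decomposition *)

Lemma cvg_exp_sum (R : realType) (I : finType) (a b : I -> R) :
  \sum_i series (exp_coeff (a i)) n * b i @[n --> \oo] --> \sum_i expR (a i) * b i.
Proof.
apply: (@cvg_big _ _ +%R) => [|i _]; first exact: add_continuous.
by apply: cvgMr_tmp; exact: is_cvg_series_exp_coeff.
Qed.

(** Intermediate between a chain and a flow: orthonormal eigenfunctions of [gen] and the kernel they
    define. [sc_le] says that the one-step probabilities to either neighbour are at most 1, as the
    lazy step requires. *)
Record bd_spectrum (R : realType) := BDSpectrum {
  sN : nat;
  sp : nat -> R;
  sc : nat -> R;
  lam : 'I_sN.+1 -> R;
  phi : 'I_sN.+1 -> nat -> R;
  sker : R -> nat -> nat -> R;
  sp_gt0 : forall x, (x <= sN)%N -> 0 < sp x;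
  sp_sum1 : \sum_(0 <= x < sN.+1) sp x = 1;
  sc_gt0 : forall x, (x < sN)%N -> 0 < sc x;
  sc_top : sc sN = 0;
  sc_le : forall x, (x < sN)%N -> sc x <= sp x /\ sc x <= sp x.+1;
  phi_orth : forall i j,
    mean sN sp (fun y => phi i y * phi j y) = (i == j)%:R;
  phi_complete : forall x y, (x <= sN)%N -> (y <= sN)%N ->
    \sum_i phi i x * phi i y = (x == y)%:R / sp y;
  phi_eigen : forall i x, (x <= sN)%N ->
    gen sp sc (phi i) x = - lam i * phi i x;
  skerE : forall (t : R) x y, (x <= sN)%N -> (y <= sN)%N ->
    sker t x y = \sum_i expR (- t * lam i) * phi i x * phi i y * sp y }.

Section Spectrum.
Context {R : realType} (S : bd_spectrum R).
Local Notation N := (sN S).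
Local Notation p := (sp S).
Local Notation c := (sc S).
Local Notation lam := (@lam R S).
Local Notation phi := (@phi R S).
Local Notation h := (sker S).
Local Notation E := (mean N p).
Local Notation H := (evolve N h).
Local Notation L := (gen p c).
Implicit Types (f g : nat -> R) (x y z k : nat) (i j : 'I_N.+1).

Definition coef f i : R := E (fun y => phi i y * f y).

Lemma expansion f x : (x <= N)%N -> f x = \sum_i coef f i * phi i x.
Proof.
move=> xN; have px := sp_gt0 xN.
transitivity (\sum_(0 <= y < N.+1) (\sum_i phi i y * phi i x) * (p y * f y)).
  rewrite (sum_nat_split _ (leq0n x)) 1?ltnW// [X in _ + X]big_ltn//.
  rewrite phi_complete// eqxx sum_nat_eq0 ?sum_nat_eq0 ?addr0 ?add0r.
  - by rewrite mul1r mulKf// gt_eqF.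
  - by move=> y /andP[xy yN]; rewrite phi_complete// gtn_eqF// !mul0r.
  - by move=> y /andP[_ yx]; rewrite phi_complete// ?ltn_eqF// ?mul0r//; lia.
under eq_bigr => y _ do rewrite mulr_suml.
rewrite exchange_big/=; apply: eq_bigr => i _.
by rewrite mulr_suml; apply: eq_bigr => y _; ring.
Qed.

Lemma mean_sum (I : finType) (F : I -> nat -> R) :
  E (fun y => \sum_i F i y) = \sum_i E (F i).
Proof.
rewrite /mean exchange_big/=; apply: eq_bigr => y _.
by rewrite mulr_sumr.
Qed.

Lemma meanZ a f : E (fun y => a * f y) = a * E f.
Proof. by rewrite /mean mulr_sumr; apply: eq_bigr => y _; rewrite mulrCA. Qed.

Lemma eq_mean f g : (forall y, (y <= N)%N -> f y = g y) -> E f = E g.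
Proof. by move=> fg; apply: eq_big_nat => y /andP[_ yN]; rewrite fg. Qed.

Lemma coef_sum (a : 'I_N.+1 -> R) i : coef (fun y => \sum_j a j * phi j y) i = a i.
Proof.
rewrite /coef; under (@eq_mean _ (fun y => \sum_j a j * (phi i y * phi j y))).
  by move=> y _; rewrite mulr_sumr; apply: eq_bigr => j _; rewrite mulrCA.
rewrite mean_sum (bigD1 i)//= meanZ phi_orth eqxx mulr1 big1 ?addr0// => j ji.
by rewrite meanZ phi_orth eq_sym (negPf ji) mulr0.
Qed.

Lemma eq_coef f g i : (forall y, (y <= N)%N -> f y = g y) -> coef f i = coef g i.
Proof. by move=> fg; apply: eq_mean => y yN; rewrite fg. Qed.

Lemma parseval f g : E (fun y => f y * g y) = \sum_i coef f i * coef g i.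
Proof.
under (@eq_mean _ (fun y => \sum_i coef f i * (phi i y * g y))).
  move=> y yN; rewrite {1}(expansion f yN) mulr_suml.
  by apply: eq_bigr => i _; rewrite mulrA.
by rewrite mean_sum; apply: eq_bigr => i _; rewrite meanZ.
Qed.

Lemma eq_gen f g x : (x <= N)%N -> (forall y, (y <= N)%N -> f y = g y) ->
  L f x = L g x.
Proof.
move=> xN fg; rewrite /gen; congr (_ / _); congr (_ + _); last first.
  by rewrite !fg//; lia.
have [->|xn] := eqVneq x N; first by rewrite sc_top !mul0r.
by rewrite !fg//; lia.
Qed.

Lemma gen_sum (a : 'I_N.+1 -> R) x : (x <= N)%N ->
  L (fun y => \sum_i a i * phi i y) x = \sum_i a i * (- lam i * phi i x).
Proof.
move=> xN; under [RHS]eq_bigr => i _ do rewrite -phi_eigen//.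
rewrite /gen -!sumrB !mulr_sumr -big_split/= mulr_suml.
by apply: eq_bigr => i _; ring.
Qed.

Lemma gen_expansion f x : (x <= N)%N ->
  L f x = \sum_i - lam i * coef f i * phi i x.
Proof.
move=> xN; rewrite (eq_gen xN (fun y yN => expansion f yN)) gen_sum//.
by apply: eq_bigr => i _; ring.
Qed.

Lemma coef_gen f i : coef (L f) i = - lam i * coef f i.
Proof. by rewrite (eq_coef _ (fun y yN => gen_expansion f yN)) coef_sum. Qed.

Lemma evolveE (t : R) f x : (x <= N)%N ->
  H t f x = \sum_i expR (- t * lam i) * coef f i * phi i x.
Proof.
move=> xN; transitivity (\sum_(0 <= y < N.+1)
    \sum_i expR (- t * lam i) * phi i x * (p y * (phi i y * f y))).
  apply: eq_big_nat => y /andP[_ yN]; rewrite skerE// mulr_suml.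
  by apply: eq_bigr => i _; ring.
rewrite exchange_big/=; apply: eq_bigr => i _.
by rewrite -mulr_sumr mulrAC.
Qed.

(** Summation by parts; the boundary flux of the partial sum up to [n] vanishes at [n = N] by
    [sc_top]. *)
Lemma green f : E (fun x => f x * L f x) = - energy N c f.
Proof.
have aux n : (n <= N)%N -> \sum_(0 <= x < n.+1) p x * (f x * L f x) =
    - (\sum_(0 <= x < n) c x * (f x.+1 - f x) ^+ 2) + f n * (c n * (f n.+1 - f n)).
  elim: n => [|n IH] nN.
    rewrite big_nat1 big_geq// /gen/= subrr mulr0.
    by field; rewrite gt_eqF ?sp_gt0.
  rewrite big_nat_recr//= IH ?(ltnW nN)// [in RHS]big_nat_recr//= /gen/=.
  by field; rewrite gt_eqF ?sp_gt0.
by rewrite /mean aux// sc_top mul0r mulr0 addr0.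
Qed.

Lemma energyE f : energy N c f = \sum_i lam i * coef f i ^+ 2.
Proof.
apply: oppr_inj; rewrite -green parseval -sumrN; apply: eq_bigr => i _.
by rewrite coef_gen; ring.
Qed.

Lemma coef_phi i j : coef (phi i) j = (i == j)%:R.
Proof. by rewrite /coef phi_orth eq_sym. Qed.

Lemma energy_phi i : energy N c (phi i) = lam i.
Proof.
rewrite energyE (bigD1 i)//= coef_phi eqxx expr1n mulr1 big1 ?addr0// => j ji.
by rewrite coef_phi eq_sym (negPf ji) expr0n mulr0.
Qed.

Lemma lam_ge0 i : 0 <= lam i. Proof. by rewrite -energy_phi energy_ge0//; exact: sc_gt0. Qed.

Lemma lam0_cst i x : lam i = 0 -> (x <= N)%N -> phi i x = phi i 0.
Proof.
move=> li0; elim: x => [//|x IH] xN; rewrite -IH ?(ltnW xN)//.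
have : energy N c (phi i) = 0 by rewrite energy_phi.
rewrite /energy big_mkord => /psumr_eq0P e0.
have := e0 _ (Ordinal xN) isT => /=.
have e : forall y : 'I_N, true -> 0 <= c y * (phi i y.+1 - phi i y) ^+ 2.
  by move=> y _; rewrite mulr_ge0 ?sqr_ge0// ltW// sc_gt0.
move=> /(_ e)/eqP; rewrite mulf_eq0 gt_eqF ?sc_gt0//= sqrf_eq0 subr_eq0.
by move=> /eqP.
Qed.

Lemma mean_cst a : E (fun=> a) = a.
Proof. by rewrite /mean -mulr_suml sp_sum1 mul1r. Qed.

(** Some eigenfunction is not orthogonal to constants, and its eigenvalue is 0. Eigenvalue 0 means
    zero energy, hence a constant function, and two constants cannot be orthonormal. The sign of
    [phi i0] stays open, hence the square. *)
Lemma ground_state : exists2 i0, lam i0 = 0 /\ phi i0 0 ^+ 2 = 1 &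
  forall i, i != i0 -> lam i != 0.
Proof.
have [i0 ci0] : exists i, coef (fun=> 1) i != 0.
  apply/existsP; apply: contraT; rewrite negb_exists => /forallP c0.
  have /eqP := expansion (fun=> 1) (leq0n N).
  rewrite big1 ?oner_eq0// => i _; have := c0 i; rewrite negbK => /eqP ->.
  by rewrite mul0r.
have l0 : lam i0 = 0.
  apply/eqP; have /eqP := coef_gen (fun=> 1) i0.
  rewrite (@eq_coef _ (fun=> 0)); last first.
    by move=> y _; rewrite /gen !subrr !mulr0 addr0 mul0r.
  have -> : coef (fun=> 0) i0 = 0.
    by rewrite /coef (@eq_mean _ (fun=> 0)) ?mean_cst// => y _; rewrite mulr0.
  by rewrite eq_sym mulNr oppr_eq0 mulf_eq0 (negPf ci0) orbF.
have n0 i j : lam i = 0 -> lam j = 0 -> phi i 0 * phi j 0 = (i == j)%:R.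
  move=> li lj; rewrite -phi_orth -[LHS]mean_cst; apply: eq_mean => y yN.
  by rewrite (lam0_cst li yN) (lam0_cst lj yN).
exists i0; first by split=> //; rewrite expr2 n0// eqxx.
move=> i ii0; apply/negP => /eqP li.
have := n0 i i0 li l0; rewrite (negPf ii0) => /eqP.
have := n0 i i li li; have := n0 i0 i0 l0 l0; rewrite !eqxx => a1 a2.
rewrite mulf_eq0 => /orP[] /eqP e0.
  by move: a2; rewrite e0 mul0r => /eqP; rewrite eq_sym oner_eq0.
by move: a1; rewrite e0 mul0r => /eqP; rewrite eq_sym oner_eq0.
Qed.

Lemma coef_ground f i0 : lam i0 = 0 -> coef f i0 = phi i0 0 * E f.
Proof.
move=> l0; rewrite -meanZ; apply: eq_mean => y yN.
by rewrite (lam0_cst l0 yN).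
Qed.

Variable gap : R.
Hypotheses (gap_gt0 : 0 < gap) (gap_le : forall i, lam i != 0 -> gap <= lam i).

Lemma spectral_poincare f :
  E (fun x => f x ^+ 2) - E f ^+ 2 <= gap^-1 * energy N c f.
Proof.
have [i0 [l0 p1] lne] := ground_state.
have -> : E (fun x => f x ^+ 2) = \sum_i coef f i ^+ 2.
  rewrite (@eq_mean _ (fun x => f x * f x)) => [|y _]; last by rewrite expr2.
  by rewrite parseval; apply: eq_bigr => i _; rewrite expr2.
rewrite (bigD1 i0)//= (coef_ground f l0) exprMn p1 mul1r addrAC subrr add0r.
rewrite energyE [X in _ <= _ * X](bigD1 i0)//= l0 mul0r add0r mulr_sumr.
apply: ler_sum => i /lne li; rewrite mulrA -[leLHS]mul1r ler_wpM2r ?sqr_ge0//.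
by rewrite mulrC ler_pdivlMr ?gap_gt0// mul1r gap_le.
Qed.

(** [f] is the Green function at [z], solving [- L f = delta_z / p z - 1], with coefficients
    [phi i z / lam i]. The density minus 1 has coefficients [expR (- s * lam i) * phi i z], and
    [expR (- v) <= 1 / v] at [v = 2 * s * lam i] compares the two sums. *)
Lemma spectral_smoothing z : (z <= N)%N -> exists f : nat -> R,
  [/\ E f = 0, f z = energy N c f &
    forall s : R, 0 < s ->
      E (fun y => (h s z y / p y - 1) ^+ 2) <= f z / (2 * s)].
Proof.
move=> zN; have [i0 [l0 p1] lne] := ground_state.
pose a i := if i == i0 then 0 else phi i z / lam i.
pose f y := \sum_i a i * phi i y.
have cf i : coef f i = a i by rewrite /f coef_sum.
have fz : f z = \sum_(i | i != i0) phi i z ^+ 2 / lam i.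
  rewrite /f (bigD1 i0)//= /a eqxx mul0r add0r; apply: eq_bigr => i ii0.
  by rewrite (negPf ii0); ring.
exists f; split.
- have := coef_ground f l0; rewrite cf /a eqxx => /esym/eqP.
  rewrite mulf_eq0 => /orP[/eqP e0|/eqP//].
  by move: p1; rewrite e0 expr0n => /eqP; rewrite eq_sym oner_eq0.
- rewrite fz energyE [RHS](bigD1 i0)//= l0 mul0r add0r; apply: eq_bigr => i ii0.
  by rewrite cf /a (negPf ii0); field; exact: lne.
move=> s s0.
pose b i := if i == i0 then 0 else expR (- s * lam i) * phi i z.
have hb y : (y <= N)%N -> h s z y / p y - 1 = \sum_i b i * phi i y.
  move=> yN; have py := sp_gt0 yN; rewrite skerE// mulr_suml.
  rewrite (bigD1 i0)//= [in RHS](bigD1 i0)//= /b eqxx mul0r add0r l0 mulr0 expR0.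
  rewrite (lam0_cst l0 zN) (lam0_cst l0 yN).
  have -> : 1 * phi i0 0 * phi i0 0 * p y / p y = 1.
    by rewrite mul1r -expr2 p1 mul1r divff// gt_eqF.
  rewrite addrAC subrr add0r; apply: eq_bigr => i ii0; rewrite (negPf ii0).
  by field; rewrite gt_eqF.
have -> : E (fun y => (h s z y / p y - 1) ^+ 2) = \sum_i b i ^+ 2.
  rewrite (@eq_mean _ (fun y => (\sum_i b i * phi i y) * (\sum_i b i * phi i y))).
    by rewrite parseval; apply: eq_bigr => i _; rewrite coef_sum expr2.
  by move=> y yN; rewrite hb// expr2.
rewrite fz (bigD1 i0)//= /b eqxx expr0n add0r mulr_suml.
apply: ler_sum => i ii0; rewrite (negPf ii0) exprMn mulrC -mulrA.
rewrite ler_wpM2l ?sqr_ge0// -invfM -expRM_natl.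
have li : 0 < lam i by rewrite lt_def lne// lam_ge0.
have sl : 0 < lam i * (2 * s) by rewrite !mulr_gt0.
rewrite -[leLHS]invrK lef_pV2 ?posrE ?invr_gt0 ?expR_gt0// -expRN.
apply: le_trans (expR_ge1Dx _); lra.
Qed.

(* A nonnegative cone that is stable under the lazy step [f + L f / 2] is stable
   under the semigroup, the exponential of a multiple of that step. *)
Definition lazy_step f : nat -> R := fun x => f x + 2^-1 * L f x.

Lemma coef_lazy f k i : coef (iter k lazy_step f) i = (1 - 2^-1 * lam i) ^+ k * coef f i.
Proof.
elim: k => [|k IH]; first by rewrite expr0 mul1r.
rewrite exprS -mulrA -IH iterS; set g := iter k lazy_step f.
rewrite {1}/coef (@eq_mean _ (fun y => \sum_(b : bool) (if b then phi i y * g y else 2^-1 * (phi i y * L g y)))).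
  rewrite mean_sum big_bool/= meanZ -/(coef g i) -/(coef (L g) i) coef_gen; ring.
by move=> y _; rewrite big_bool/= /lazy_step; ring.
Qed.

(** A signed combination of point values covers both cones in use: one point for positivity, a
    difference of two points for monotonicity. The factor [expR (- (2 * t))] is split off, leaving a
    power series in the lazy step with nonnegative coefficients. *)
Lemma evolve_lazy_ge0 (I : finType) (w : I -> R) (q : I -> nat) (t : R) f : 0 <= t ->
    (forall l, (q l <= N)%N) ->
    (forall k, 0 <= \sum_l w l * iter k lazy_step f (q l)) ->
  0 <= \sum_l w l * H t f (q l).
Proof.
move=> t0 qN pos.
pose u i : R := \sum_l w l * phi i (q l).
pose B i : R := t * (2 - lam i).
have -> : \sum_l w l * H t f (q l) =
    expR (- (2 * t)) * \sum_i expR (B i) * (coef f i * u i).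
  rewrite mulr_sumr.
  transitivity (\sum_l \sum_i expR (- t * lam i) * coef f i * (w l * phi i (q l))).
    apply: eq_bigr => l _; rewrite evolveE// mulr_sumr.
    by apply: eq_bigr => i _; ring.
  rewrite exchange_big/=; apply: eq_bigr => i _; rewrite -mulr_sumr mulrA -expRD.
  by rewrite -mulrA; congr (expR _ * _); rewrite /B; ring.
rewrite mulr_ge0 ?expR_ge0//.
have cv := @cvg_exp_sum _ _ B (fun i => coef f i * u i).
rewrite -(cvg_lim (@Rhausdorff R) cv).
apply: limr_ge; first by apply/cvg_ex; eexists; exact: cv.
near=> n; rewrite /series/= -/(series _).
have -> : \sum_i (\sum_(0 <= k < n) exp_coeff (B i) k) * (coef f i * u i) =
    \sum_(0 <= k < n) (2 * t) ^+ k / k`!%:R *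
      \sum_l w l * iter k lazy_step f (q l).
  under eq_bigr => i _ do rewrite mulr_suml.
  rewrite exchange_big/=; apply: eq_bigr => k _.
  transitivity ((2 * t) ^+ k / k`!%:R * \sum_i coef (iter k lazy_step f) i * u i).
    rewrite mulr_sumr; apply: eq_bigr => i _; rewrite coef_lazy /exp_coeff/=.
    have -> : B i = (2 * t) * (1 - 2^-1 * lam i) by rewrite /B; field.
    by rewrite exprMn; ring.
  congr (_ * _).
  transitivity (\sum_i \sum_l coef (iter k lazy_step f) i * (w l * phi i (q l))).
    by apply: eq_bigr => i _; rewrite mulr_sumr.
  rewrite exchange_big/=; apply: eq_bigr => l _.
  by rewrite (expansion _ (qN l)) mulr_sumr; apply: eq_bigr => i _; ring.
apply: sum_nat_ge0 => k _.
by rewrite mulr_ge0// divr_ge0// exprn_ge0// mulr_ge0.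
Unshelve. all: by end_near. Qed.

Lemma lazy_step_ge0 f : (forall x, (x <= N)%N -> 0 <= f x) ->
  forall x, (x <= N)%N -> 0 <= lazy_step f x.
Proof.
move=> f0 x xN; rewrite /lazy_step /gen.
have px := sp_gt0 xN; rewrite mulrA -[f x](mulfK (lt0r_neq0 px)) -mulrDl.
rewrite divr_ge0 ?(ltW px)// mulfK ?gt_eqF//.
have up : 0 <= p x * f x + c x * (f x.+1 - f x).
  have [->|xn] := eqVneq x N; first by rewrite sc_top mul0r addr0 mulr_ge0 ?f0// ltW// sp_gt0.
  have xlt : (x < N)%N by lia.
  have [c1 _] := sc_le xlt; have c0 := sc_gt0 xlt.
  have h1 : 0 <= c x * f x.+1 by rewrite mulr_ge0 ?f0// ltW.
  have h2 : c x * f x <= p x * f x by rewrite ler_wpM2r ?f0.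
  lra.
have dn : 0 <= p x * f x + c x.-1 * (f x.-1 - f x).
  case: x xN {up px} => [|x] xN /=.
    by rewrite subrr mulr0 addr0 mulr_ge0 ?f0// ltW// sp_gt0.
  have [_ c1] := sc_le xN; have c0 := sc_gt0 xN.
  have h1 : 0 <= c x * f x by rewrite mulr_ge0 ?f0 ?(ltW c0)// ltnW.
  have h2 : c x * f x.+1 <= p x.+1 * f x.+1 by rewrite ler_wpM2r ?f0.
  lra.
lra.
Qed.

(** Exchange across the edge {x, x+1} shrinks the difference [f x - f x.+1] by at most half of it at
    each endpoint, which is where the factor 1/2 counts; exchange over the neighbouring edges only
    widens it. *)
Lemma lazy_step_noninc f : (forall x, (x < N)%N -> f x.+1 <= f x) ->
  forall x, (x < N)%N -> lazy_step f x.+1 <= lazy_step f x.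
Proof.
move=> fle x xN; have fx := fle _ xN.
have px := @sp_gt0 _ S x (ltnW xN); have px1 := sp_gt0 xN.
have [c1 c2] := sc_le xN; have c0 := sc_gt0 xN.
have up : 0 <= c x.+1 / p x.+1 * (f x.+1 - f x.+2).
  have [->|xn] := eqVneq x.+1 N; first by rewrite sc_top !mul0r.
  have xlt : (x.+1 < N)%N by lia.
  by rewrite mulr_ge0 ?subr_ge0 ?fle// divr_ge0// ltW// sc_gt0.
have dn : 0 <= c x.-1 / p x * (f x.-1 - f x).
  case: x xN px {fx px1 c1 c2 c0 up} => [|x] xN px /=; first by rewrite subrr mulr0.
  have xN' := ltnW xN.
  by rewrite mulr_ge0 ?subr_ge0 ?fle// divr_ge0// ltW// sc_gt0.
have a1 : c x / p x <= 1 by rewrite ler_pdivrMr// mul1r.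
have b1 : c x / p x.+1 <= 1 by rewrite ler_pdivrMr// mul1r.
have a2 : c x / p x * (f x - f x.+1) <= f x - f x.+1.
  by rewrite -[leRHS]mul1r ler_wpM2r// subr_ge0.
have b2 : c x / p x.+1 * (f x - f x.+1) <= f x - f x.+1.
  by rewrite -[leRHS]mul1r ler_wpM2r// subr_ge0.
rewrite /lazy_step /gen/= [in leLHS]mulrDl [in leRHS]mulrDl; lra.
Qed.

Lemma spectral_evolve_ge0 t f x : 0 <= t -> (x <= N)%N ->
  (forall y, (y <= N)%N -> 0 <= f y) -> 0 <= H t f x.
Proof.
move=> t0 xN f0.
have := @evolve_lazy_ge0 'I_1 (fun=> 1) (fun=> x) t f t0 (fun=> xN).
rewrite big_ord1 mul1r; apply => k; rewrite big_ord1 mul1r.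
elim: k x xN => [|k IH] x xN; [exact: f0|exact: lazy_step_ge0].
Qed.

Lemma spectral_evolve_noninc t f x : 0 <= t -> (forall y, (y < N)%N -> f y.+1 <= f y) ->
  (x < N)%N -> H t f x.+1 <= H t f x.
Proof.
move=> t0 fle xN.
have := @evolve_lazy_ge0 bool (fun b => if b then 1 else -1)
  (fun b => if b then x else x.+1) t f t0.
rewrite big_bool/= mul1r mulN1r subr_ge0; apply; first by case; rewrite ?xN ?(ltnW xN).
move=> k; rewrite big_bool/= mul1r mulN1r subr_ge0.
elim: k x xN => [|k IH] x xN; [exact: fle|exact: lazy_step_noninc].
Qed.

Definition flow_of_spectrum : bd_flow R.
Proof.
apply: (@BDFlow R N p c h gap^-1).
- exact: sp_gt0.
- exact: sp_sum1.
- exact: sc_gt0.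
- exact: sc_top.
- move=> t x y t0 xN yN.
  have := @spectral_evolve_ge0 t (fun z => (z == y)%:R) x t0 xN (fun _ _ => ler0n _ _).
  rewrite /evolve (sum_nat_split _ (leq0n y)) 1?ltnW// [X in _ + X]big_ltn// eqxx mulr1.
  rewrite !sum_nat_eq0 ?addr0 ?add0r// => z /andP[? ?].
    by rewrite gtn_eqF ?mulr0.
  by rewrite ltn_eqF ?mulr0.
- move=> t x t0 xN; have := evolveE t (fun=> 1) xN.
  rewrite /evolve; under eq_bigr => y _ do rewrite mulr1.
  move=> ->; rewrite [RHS](expansion (fun=> 1) xN); apply: eq_bigr => i _.
  have : lam i * coef (fun=> 1) i = 0.
    apply: oppr_inj; rewrite -mulNr -coef_gen oppr0 /coef.
    rewrite (@eq_mean _ (fun=> 0)) ?mean_cst// => y _.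
    by rewrite /gen !subrr !mulr0 addr0 mul0r mulr0.
  by move=> /eqP; rewrite mulf_eq0 => /orP[] /eqP ->; rewrite ?mulr0 ?expR0 ?mul1r ?mul0r.
- move=> x y xN yN; have py := sp_gt0 yN; rewrite skerE//.
  rewrite (eq_bigr (fun i => phi i x * phi i y * p y)) => [|i _].
    by rewrite -mulr_suml phi_complete// divfK// gt_eqF.
  by rewrite oppr0 mul0r expR0 mul1r.
- move=> s t x y xN yN.
  pose g z := h t z y.
  have cg i : coef g i = expR (- t * lam i) * phi i y * p y.
    rewrite (@eq_coef _ (fun z => \sum_j (expR (- t * lam j) * phi j y * p y) * phi j z)).
      by rewrite coef_sum.
    by move=> z zN; rewrite /g skerE//; apply: eq_bigr => j _; ring.
  have := evolveE s g xN; rewrite /evolve /g => ->; rewrite skerE//.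
  apply: eq_bigr => i _; rewrite cg -/g.
  have -> : - (s + t) * lam i = - s * lam i + - t * lam i by ring.
  rewrite expRD; ring.
- move=> t x y xN yN; rewrite !skerE// !mulr_sumr.
  by apply: eq_bigr => i _; ring.
- by move=> t f t0 fle x xN; apply: spectral_evolve_noninc.
- move=> f t x xN.
  have -> : (fun s => H s f x) = (fun s => \sum_i expR (- s * lam i) * coef f i * phi i x).
    by apply/funext => s; rewrite evolveE.
  rewrite evolveE//.
  have -> : (fun s : R => \sum_i expR (- s * lam i) * coef f i * phi i x) =
      \sum_i (fun s : R => expR (- s * lam i) * coef f i * phi i x).
    by apply/funext => s; rewrite fct_sumE.
  have -> : \sum_i expR (- t * lam i) * coef (L f) i * phi i x =
      \sum_i (- lam i * (expR (- t * lam i) * coef f i * phi i x)).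
    by apply: eq_bigr => i _; rewrite coef_gen; ring.
  apply: is_derive_sum => i.
  apply: is_derive_eq.
  rewrite !(scaler0, scaler1, subr0, addr0, add0r) /GRing.scale/=; ring.
- by rewrite invr_gt0 gap_gt0.
- exact: spectral_poincare.
- exact: spectral_smoothing.
Defined.

(* The eigenfunction of [lam i] is contracted exactly at the rate [lam i]. *)
Lemma tv_ge_exp i : lam i != 0 -> exists2 x, (x <= N)%N &
  forall t : R, 0 <= t -> expR (- t * lam i) <= 2 * tv flow_of_spectrum t x.
Proof.
move=> li0.
(* At a maximum of [|phi i|] the test function [phi i] is bounded by its own value there, which
   cancels; [x] does not depend on [t]. *)
pose x := [arg max_(y > (ord0 : 'I_N.+1)) `|phi i y|]%O.
have xmax y : (y <= N)%N -> `|phi i y| <= `|phi i x|.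
  move=> yN; rewrite /x; case: arg_maxP => //= z _ zmax.
  by have := zmax (Ordinal (yN : (y < N.+1)%N)) isT.
have x0 : 0 < `|phi i x|.
  rewrite lt_def normr_ge0 andbT; apply/negP => /eqP e0.
  have := phi_orth i i; rewrite eqxx (@eq_mean _ (fun=> 0)) ?mean_cst.
    by move=> /eqP; rewrite eq_sym oner_eq0.
  move=> y yN; have := xmax _ yN; rewrite e0 normr_le0 => /eqP ->.
  by rewrite mul0r.
have Ephi : E (phi i) = 0.
  have [i0 [l0 p1] _] := ground_state.
  have := coef_ground (phi i) l0; rewrite coef_phi.
  have [e|_ /esym/eqP] := eqVneq i i0; first by rewrite e l0 eqxx in li0.
  rewrite mulf_eq0 => /orP[/eqP e0|/eqP//].
  by move: p1; rewrite e0 expr0n => /eqP; rewrite eq_sym oner_eq0.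
exists x => [|t t0]; first by rewrite -ltnS ltn_ord.
have xN : (x <= N)%N by rewrite -ltnS ltn_ord.
rewrite /tv mulrA mulfV// mul1r -(ler_pM2r x0) mulr_suml.
have -> : expR (- t * lam i) * `|phi i x| = `|H t (phi i) x - E (phi i)|.
  rewrite Ephi subr0 evolveE// (bigD1 i)//= coef_phi eqxx big1 ?addr0.
    by rewrite mulr1 normrM ger0_norm ?expR_ge0.
  by move=> j ji; rewrite coef_phi eq_sym (negPf ji) mulr0 mul0r.
rewrite /evolve /mean -sumrB; apply: le_trans (ler_norm_sum _ _ _) _.
apply: le_sum_nat => y /andP[_ yN]; rewrite -mulrBl normrM ler_wpM2l//.
exact: xmax.
Qed.

End Spectrum.

(** * From chains to semigroups *)

Section Chain.
Context {R : realType} (X : bd_chain R) (irr : irreducible X).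
Local Notation N := (bd_top X).
Local Notation P := (bd_P X).
Implicit Types (x y z : 'I_N.+1) (f : nat -> R) (n k : nat).

Let P_ge0 x y : 0 <= P x y. Proof. exact: (proj1 (bd_stochastic X)). Qed.
Let P_sum1 x : \sum_y P x y = 1. Proof. exact: (proj2 (bd_stochastic X)). Qed.

Lemma P_le1 x y : P x y <= 1.
Proof. by rewrite -(P_sum1 x) (bigD1 y)//= lerDl sumr_ge0. Qed.

Lemma P_far x y : (x.+1 < y)%N || (y.+1 < x)%N -> P x y = 0.
Proof. by move=> xy; apply: bd_nearest; lia. Qed.

(* If the edge from [x] to [y] is missing, no power of [P] crosses it. *)
Lemma P_up x y : y = x.+1 :> nat -> 0 < P x y.
Proof.
move=> yx; rewrite lt_def P_ge0 andbT; apply/negP => /eqP Pxy.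
suff H k (u v : 'I_N.+1) : (u <= x)%N -> (x < v)%N -> (P ^+ k) u v = 0.
  by have [k] := irr x y; rewrite H ?ltxx// yx.
move=> ux; elim: k v => [|k IH] v xv.
  by rewrite expr0 mxE (_ : u == v = false)//; apply/negP => /eqP uv; subst; lia.
rewrite exprSr mxE big1// => w _; have [wx|xw] := leqP w x; last by rewrite IH ?mul0r.
have [wv|wv] := ltnP w.+1 v; first by rewrite P_far ?wv// mulr0.
have -> : w = x by apply: val_inj => /=; lia.
have -> : v = y by apply: val_inj => /=; lia.
by rewrite Pxy mulr0.
Qed.

Lemma P_down x y : x = y.+1 :> nat -> 0 < P x y.
Proof.
move=> xy; rewrite lt_def P_ge0 andbT; apply/negP => /eqP Pxy.
suff H k (u v : 'I_N.+1) : (x <= u)%N -> (v < x)%N -> (P ^+ k) u v = 0.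
  by have [k] := irr x y; rewrite H ?ltxx// xy.
move=> xu; elim: k v => [|k IH] v vx.
  by rewrite expr0 mxE (_ : u == v = false)//; apply/negP => /eqP uv; subst; lia.
rewrite exprSr mxE big1// => w _; have [xw|wx] := leqP x w; last by rewrite IH ?mul0r.
have [wv|wv] := ltnP v.+1 w; first by rewrite P_far ?wv ?orbT// mulr0.
have -> : w = x by apply: val_inj => /=; lia.
have -> : v = y by apply: val_inj => /=; lia.
by rewrite Pxy mulr0.
Qed.

Definition pn (n k : nat) : R := P (inord n) (inord k).

Lemma pn_up n : (n < N)%N -> 0 < pn n n.+1.
Proof. by move=> nN; apply: P_up; rewrite !inordK ?ltnS// ltnW. Qed.

Lemma pn_down n : (n < N)%N -> 0 < pn n.+1 n.
Proof. by move=> nN; apply: P_down; rewrite !inordK ?ltnS// ltnW. Qed.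

(** Solution of detailed balance across successive edges, before normalization. *)
Definition weight n : R := \prod_(0 <= z < n) (pn z z.+1 / pn z.+1 z).

Lemma weight_gt0 n : (n <= N)%N -> 0 < weight n.
Proof.
move=> nN; rewrite /weight big_nat; apply: prodr_gt0 => z /andP[_ zn].
by rewrite divr_gt0 ?pn_up ?pn_down//; lia.
Qed.

Lemma weight_balance n : (n < N)%N ->
  weight n * pn n n.+1 = weight n.+1 * pn n.+1 n.
Proof.
move=> nN; rewrite /weight [in RHS]big_nat_recr//= -[RHS]mulrA divfK//.
by rewrite gt_eqF// pn_down.
Qed.

Definition pst n : R := weight n / \sum_(0 <= z < N.+1) weight z.

Lemma weight_sum_gt0 : 0 < \sum_(0 <= z < N.+1) weight z.
Proof.
rewrite big_nat_recr//= ltr_wpDl ?weight_gt0//.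
by apply: sum_nat_ge0 => z /andP[_ zN]; rewrite ltW// weight_gt0// ltnW.
Qed.

Lemma pst_gt0 n : (n <= N)%N -> 0 < pst n.
Proof. by move=> nN; rewrite divr_gt0 ?weight_gt0 ?weight_sum_gt0. Qed.

Lemma pst_sum1 : \sum_(0 <= n < N.+1) pst n = 1.
Proof. by rewrite -mulr_suml divff// gt_eqF// weight_sum_gt0. Qed.

Lemma pst_balance n : (n < N)%N -> pst n * pn n n.+1 = pst n.+1 * pn n.+1 n.
Proof. by move=> nN; rewrite mulrAC weight_balance// mulrAC. Qed.

Definition pcond n : R := if (n < N)%N then pst n * pn n n.+1 else 0.

Lemma reversible x y : pst x * P x y = pst y * P y x.
Proof.
wlog xy : x y / (x <= y)%N => [H|].
  by have [/H//|/ltnW/H] := leqP x y.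
have [->//|xny] := eqVneq x y.
have {}xy : (x < y)%N by rewrite ltn_neqAle xy andbT.
have [far|near] := ltnP x.+1 y.
  by rewrite !P_far ?far ?orbT// !mulr0.
have xN : (x < N)%N by rewrite -ltnS (leq_trans _ (ltn_ord y)).
have e : y = x.+1 :> nat by lia.
have := pst_balance xN; rewrite /pn -e !inord_val//.
Qed.

Lemma genP f x : gen pst pcond f x = \sum_y P x y * f y - f x.
Proof.
have px := @pst_gt0 x; rewrite -ltnS in px; have {}px := px (ltn_ord x).
rewrite -[X in _ - X]mul1r -(P_sum1 x) mulr_suml -sumrB.
transitivity (\sum_(0 <= y < N.+1) pn x y * (f y - f x)); last first.
  by rewrite big_mkord; apply: eq_bigr => y _; rewrite /pn !inord_val -mulrBr.
have far n k : (n <= N)%N -> (k <= N)%N -> (n.+1 < k)%N || (k.+1 < n)%N -> pn n k = 0.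
  by move=> nN kN nk; rewrite /pn P_far// !inordK.
have xN : (x <= N)%N by rewrite -ltnS.
rewrite (sum_nat_split _ (leq0n x)) 1?ltnW//.
rewrite [X in _ = _ + X]big_ltn// subrr mulr0 add0r /gen mulrDl addrC.
congr (_ + _).
  move: (nat_of_ord x) xN px => [|n] nN px; first by rewrite /= subrr mulr0 mul0r big_geq.
  rewrite big_nat_recr//= sum_nat_eq0 ?add0r; last first.
    by move=> k /andP[_ kn]; rewrite far ?mul0r//; lia.
  by rewrite /pcond nN pst_balance//; field; rewrite gt_eqF.
move: (nat_of_ord x) xN px => n nN px; rewrite /pcond; case: ltnP => [ltn|Nn].
  rewrite big_ltn// sum_nat_eq0 ?addr0; last first.
    by move=> k /andP[nk kN]; rewrite far ?mul0r//; lia.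
  by field; rewrite gt_eqF.
by rewrite big_geq ?mul0r// ltnS.
Qed.

(** The stationary law is a chosen one, so uniqueness is the point. By reversibility the density [f]
    of any stationary law is harmonic; its flux vanishes edge by edge from the left end, so [f] is
    constant. *)
Lemma stationaryE : stationary X = \row_x pst x.
Proof.
have sp0 : is_stationary P (\row_x pst x).
  split.
  - by move=> x; rewrite mxE ltW// pst_gt0// -ltnS.
  - by under eq_bigr => x _ do rewrite mxE; rewrite -(big_mkord xpredT pst) pst_sum1.
  - apply/rowP => y; rewrite !mxE; under eq_bigr => x _ do rewrite mxE reversible.
    by rewrite -mulr_sumr P_sum1 mulr1.
rewrite /stationary; case: xgetP => [mu _|/(_ _ sp0)//] [mu0 mu1 muP].
pose f n : R := mu 0 (inord n) / pst n.
have Lf x : gen pst pcond f x = 0.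
  rewrite genP; apply/eqP; rewrite subr_eq0 /f inord_val; apply/eqP.
  have px : 0 < pst x by rewrite pst_gt0// -ltnS.
  apply: (mulfI (lt0r_neq0 px)); rewrite [RHS]mulrC divfK ?gt_eqF//.
  rewrite -[in RHS]muP mxE mulr_sumr; apply: eq_bigr => y _.
  have py : 0 < pst y by rewrite pst_gt0// -ltnS.
  rewrite /= inord_val; transitivity (pst x * P x y * (mu 0 y / pst y)); first by ring.
  by rewrite reversible; field; rewrite gt_eqF.
have Lf' n : (n <= N)%N -> pcond n * (f n.+1 - f n) + pcond n.-1 * (f n.-1 - f n) = 0.
  move=> nN; have := Lf (inord n); rewrite /gen inordK// => /eqP.
  by rewrite mulf_eq0 invr_eq0 (gt_eqF (pst_gt0 nN)) orbF => /eqP.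
have df n : (n <= N)%N -> pcond n * (f n.+1 - f n) = 0.
  elim: n => [|n IH] nN; have := Lf' _ nN => /=; first by rewrite subrr mulr0 addr0.
  by have := IH (ltnW nN) => e; rewrite -[f n - f n.+1]opprB mulrN e oppr0 addr0.
have fc n : (n <= N)%N -> f n = f 0.
  elim: n => [//|n IH] nN; rewrite -IH ?(ltnW nN)//.
  have := df n (ltnW nN) => /eqP; rewrite mulf_eq0 /pcond nN.
  have pp : 0 < pst n * pn n n.+1 by rewrite mulr_gt0 ?pst_gt0 ?pn_up// ltnW.
  rewrite (gt_eqF pp) orFb subr_eq0.
  by move=> /eqP.
have muE x : mu 0 x = f 0 * pst x.
  have px : 0 < pst x by rewrite pst_gt0// -ltnS.
  have xN : (x <= N)%N by rewrite -ltnS.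
  by rewrite -(fc x xN) /f inord_val divfK// gt_eqF.
have f1 : f 0 = 1.
  rewrite -mu1; under eq_bigr => x _ do rewrite muE.
  by rewrite -mulr_sumr -(big_mkord xpredT pst) pst_sum1 mulr1.
by apply/rowP => x; rewrite muE f1 mul1r mxE.
Qed.

Let sq n : R := Num.sqrt (pst n).

Let sq_gt0 n : (n <= N)%N -> 0 < sq n.
Proof. by move=> nN; rewrite sqrtr_gt0 pst_gt0. Qed.

Let sqE n : (n <= N)%N -> pst n = sq n * sq n.
Proof. by move=> nN; rewrite -expr2 sqr_sqrtr// ltW// pst_gt0. Qed.

(** Conjugating [P] by the square roots of the stationary weights gives a symmetric matrix, by
    reversibility; dividing its eigenvectors by these roots gives eigenfunctions of [P]. *)
Lemma symmetrized_spectrum : exists (V : 'M[R]_N.+1) (d : 'I_N.+1 -> R),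
  [/\ V *m V^T = 1%:M, V^T *m V = 1%:M &
   forall i x, \sum_y P x y * (V i y / sq y) = d i * (V i x / sq x)].
Proof.
pose S : 'M[R]_N.+1 := \matrix_(x, y) (sq x * P x y / sq y).
have le x : (x <= N)%N by rewrite -ltnS.
have SS : S^T = S.
  apply/matrixP => x y; rewrite !mxE.
  have := reversible x y; rewrite !sqE// => e.
  have s1 := sq_gt0 (le x); have s2 := sq_gt0 (le y).
  apply: (mulfI (lt0r_neq0 s1)); apply: (mulfI (lt0r_neq0 s2)).
  transitivity (sq y * sq y * P y x); first by field; rewrite gt_eqF.
  by rewrite -e; field; rewrite gt_eqF.
have [V [d [VV VS]]] := symmetric_spectral SS.
exists V, (d 0); split => //; first exact: mulmx1C.
move=> i x; have s1 := sq_gt0 (le x).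
have := congr1 (fun A : 'M[R]_N.+1 => A i x) VS.
rewrite -{1}SS mul_diag_mx !mxE => e.
rewrite mulrA -e mulr_suml; apply: eq_bigr => y _; rewrite !mxE.
have s2 := sq_gt0 (le y).
by field; rewrite !gt_eqF.
Qed.

Lemma heat_kernelE (phi : 'I_N.+1 -> nat -> R) (lam : 'I_N.+1 -> R) :
    (forall x y, \sum_i phi i x * phi i y = (x == y)%:R / pst y) ->
    (forall i x, gen pst pcond (phi i) x = - lam i * phi i x) ->
  forall (t : R) x y, heat_kernel X t x y =
    \sum_i expR (- t * lam i) * phi i x * phi i y * pst y.
Proof.
move=> comp eig t x y; rewrite /heat_kernel /expmx mxE.
set A := t *: (P - 1).
have Aphi i u : \sum_z A u z * phi i z = - t * lam i * phi i u.
  rewrite -mulrA mulNr -mulrN -mulNr -eig genP mulrBr mulr_sumr.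
  under eq_bigr => z _ do rewrite !mxE mulrBr mulrBl.
  rewrite sumrB; congr (_ - _); first by apply: eq_bigr => z _; rewrite mulrA.
  rewrite (bigD1 u)//= eqxx mulr1 big1 ?addr0// => z zu.
  by rewrite eq_sym (negPf zu) mulr0 mul0r.
have Ak k u v : (A ^+ k) u v = \sum_i (- t * lam i) ^+ k * (phi i u * phi i v * pst v).
  have pv : 0 < pst v by rewrite pst_gt0// -ltnS.
  elim: k u => [|k IH] u.
    under eq_bigr => i _ do rewrite expr0 mul1r.
    by rewrite -mulr_suml comp divfK ?(gt_eqF pv)// expr0 mxE.
  rewrite exprS mxE; under eq_bigr => z _ do rewrite IH mulr_sumr.
  rewrite exchange_big/=; apply: eq_bigr => i _.
  transitivity ((\sum_z A u z * phi i z) * ((- t * lam i) ^+ k * (phi i v * pst v))).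
    by rewrite mulr_suml; apply: eq_bigr => z _; ring.
  by rewrite Aphi exprS; ring.
have cv := @cvg_exp_sum _ _ (fun i => - t * lam i) (fun i => phi i x * phi i y * pst y).
rewrite (eq_bigr (fun i => expR (- t * lam i) * (phi i x * phi i y * pst y))); last first.
  by move=> i _; ring.
rewrite -(cvg_lim (@Rhausdorff R) cv); congr (lim (_ @ \oo)).
apply/funext => n; rewrite /series/= -/(series _).
under [RHS]eq_bigr => i _ do rewrite mulr_suml.
rewrite exchange_big/=; apply: eq_bigr => k _.
by rewrite mxE Ak mulr_sumr; apply: eq_bigr => i _; rewrite /exp_coeff/=; ring.
Qed.

(** The bridge to the definitions: all later statements about a chain rest on these three
    properties. *)
Lemma bd_flow_of_chain : exists B : bd_flow R, [/\ relax B = trel X,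
  forall t e : R, 0 <= e ->
    mix_dist X t <= e <-> (forall n, (n <= top B)%N -> tv B t n <= e) &
  exists2 n, (n <= top B)%N &
    forall t : R, 0 <= t -> expR (- t / relax B) <= 2 * tv B t n].
Proof.
have le x : (x <= N)%N by rewrite -ltnS.
have [V [d [VV VV' VP]]] := symmetrized_spectrum.
pose phi (i : 'I_N.+1) (n : nat) : R := V i (inord n) / sq n.
pose lam (i : 'I_N.+1) : R := 1 - d i.
pose h (t : R) (n k : nat) : R := heat_kernel X t (inord n) (inord k).
have phiE i x : phi i x = V i x / sq x by rewrite /phi inord_val.
have orth i j : mean N pst (fun n => phi i n * phi j n) = (i == j)%:R.
  have := congr1 (fun A : 'M[R]_N.+1 => A i j) VV; rewrite !mxE => <-.
  rewrite /mean big_mkord; apply: eq_bigr => x _.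
  rewrite !phiE mxE sqE//; have s1 := sq_gt0 (le x).
  by field; rewrite gt_eqF.
have compl x y : \sum_i phi i x * phi i y = (x == y)%:R / pst y.
  have := congr1 (fun A : 'M[R]_N.+1 => A x y) VV'; rewrite !mxE => e.
  have s1 := sq_gt0 (le x); have s2 := sq_gt0 (le y).
  transitivity ((x == y)%:R / (sq x * sq y)).
    rewrite -e mulr_suml; apply: eq_bigr => i _; rewrite !phiE mxE.
    by field; rewrite !gt_eqF.
  by have [->|_] := eqVneq x y; [rewrite -sqE|rewrite !mul0r].
have eig i x : gen pst pcond (phi i) x = - lam i * phi i x.
  rewrite genP; under eq_bigr => y _ do rewrite phiE.
  by rewrite VP phiE /lam; ring.
have orth_nat n k : (n <= N)%N -> (k <= N)%N ->
    \sum_i phi i n * phi i k = (n == k)%:R / pst k.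
  move=> nN kN; have := compl (inord n) (inord k); rewrite !inordK// => ->.
  by rewrite -val_eqE/= !inordK.
have eig_nat i n : (n <= N)%N -> gen pst pcond (phi i) n = - lam i * phi i n.
  by move=> nN; have := eig i (inord n); rewrite inordK.
have hE (t : R) n k : (n <= N)%N -> (k <= N)%N ->
    h t n k = \sum_i expR (- t * lam i) * phi i n * phi i k * pst k.
  by move=> nN kN; rewrite /h (heat_kernelE compl eig) !inordK.
have cle n : (n < N)%N -> pcond n <= pst n /\ pcond n <= pst n.+1.
  move=> nN; rewrite /pcond nN; split; last rewrite pst_balance//.
    by rewrite ler_piMr ?P_le1// ltW// pst_gt0// ltnW.
  by rewrite ler_piMr ?P_le1// ltW// pst_gt0.
have c0 n : (n < N)%N -> 0 < pcond n.
  by move=> nN; rewrite /pcond nN mulr_gt0 ?pn_up ?pst_gt0// ltnW.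
have ctop : pcond N = 0 by rewrite /pcond ltnn.
pose S := @BDSpectrum R N pst pcond lam phi h pst_gt0 pst_sum1 c0 ctop cle
  orth orth_nat eig_nat hE.
have [i0 [l0 _] lne] := ground_state S.
(* There are at least two states, so the minimum defining the gap is over a nonempty set. *)
have [i2 li2] : exists i, i != i0.
  have [->|n0] := eqVneq i0 ord0; last by exists ord0; rewrite eq_sym.
  by exists ord_max; rewrite -val_eqE/= -lt0n bd_top_gt0.
pose i1 := [arg min_(i < i2 | i != i0) lam i]%O.
have [ne1 min1] : i1 != i0 /\ forall i, i != i0 -> lam i1 <= lam i.
  by rewrite /i1; case: arg_minP.
have g0 : 0 < lam i1.
  by rewrite lt_def (lne _ ne1)/=; exact: (@lam_ge0 R S).
have gle i : lam i != 0 -> lam i1 <= lam i.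
  by move=> li; apply: min1; apply: contra_neq li => ->.
have lam_eig i : eigenvalue (1 - P) (lam i).
  apply/eigenvalueP; exists (\row_x (pst x * phi i x)).
    apply/rowP => y; rewrite mulmxBr mulmx1 !mxE.
    under eq_bigr => x _ do rewrite mxE mulrAC reversible -mulrA phiE.
    by rewrite -mulr_sumr VP -phiE /lam; ring.
  apply/negP => /eqP v0; have := orth i i; rewrite eqxx /mean big_mkord big1 => [/eqP|x _].
    by rewrite eq_sym oner_eq0.
  have := congr1 (fun A : 'rV[R]_N.+1 => A 0 x) v0.
  by rewrite !mxE mulrA => ->; rewrite mul0r.
(* By completeness an eigenvector pairs nontrivially with some [phi i], and this forces its
   eigenvalue to be [lam i]. *)
have eig_lam a : eigenvalue (1 - P) a -> exists i, a = lam i.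
  move=> /eigenvalueP[v va v0].
  have [i si] : exists i, \sum_x v 0 x * phi i x != 0.
    apply/existsP; apply: contraT; rewrite negb_exists => /forallP s0.
    case/negP: v0; apply/eqP/rowP => x; rewrite mxE.
    transitivity (\sum_y v 0 y * (\sum_i phi i y * phi i x) * pst x).
      rewrite (bigD1 x)//= compl eqxx big1 => [|y yx]; last first.
        by rewrite compl (negPf yx) mul0r mulr0 mul0r.
      by rewrite addr0 mul1r -mulrA mulVf ?mulr1// gt_eqF ?pst_gt0 ?le.
    under eq_bigr => y _ do rewrite mulr_sumr mulr_suml.
    rewrite exchange_big/= big1// => i _.
    have := s0 i; rewrite negbK => /eqP e.
    transitivity ((\sum_y v 0 y * phi i y) * (phi i x * pst x)).
      by rewrite mulr_suml; apply: eq_bigr => y _; ring.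
    by rewrite e mul0r.
  exists i; apply: (mulIf si).
  transitivity (\sum_x (a *: v) 0 x * phi i x).
    by rewrite mulr_sumr; apply: eq_bigr => x _; rewrite mxE mulrA.
  rewrite -va mulmxBr mulmx1.
  transitivity (\sum_x v 0 x * phi i x - \sum_x \sum_z v 0 z * (P z x * phi i x)).
    rewrite -sumrB; apply: eq_bigr => x _; rewrite !mxE mulrBl mulr_suml.
    by congr (_ - _); apply: eq_bigr => z _; rewrite -mulrA.
  rewrite exchange_big/= /lam mulrBl mul1r; congr (_ - _).
  rewrite mulr_sumr; apply: eq_bigr => z _; rewrite -mulr_sumr.
  under eq_bigr => x _ do rewrite phiE.
  by rewrite VP -phiE mulrCA.
(* The minimum is attained, so the default value of [set_min] does not arise. *)
have sgap : spectral_gap X = lam i1.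
  have mem1 : eigenvalue (1 - P) (lam i1) /\ lam i1 != 0 by split; last exact: lne.
  have min a : eigenvalue (1 - P) a /\ a != 0 -> lam i1 <= a.
    by move=> [/eig_lam[i ->]] /gle.
  rewrite /spectral_gap /set_min; case: xgetP => [a _ [[aS a0] amin]|]; last first.
    by move=> /(_ (lam i1)) []; split.
  by apply/eqP; rewrite eq_le (min _ (conj aS a0)) andbT; apply: amin.
exists (@flow_of_spectrum R S _ g0 gle); split.
- by rewrite /trel sgap.
- move=> t e e0; rewrite /mix_dist.
  have tvE x : tv_dist (row x (heat_kernel X t)) (stationary X) =
      tv (@flow_of_spectrum R S _ g0 gle) t x.
    rewrite /tv_dist /tv/= big_mkord stationaryE; congr (_ * _).
    apply: eq_bigr => y _; rewrite /h !inord_val.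
    by congr (`| _ - _ |); rewrite mxE.
  split=> [le_e n nN|le_e].
    apply: le_trans le_e; have := tvE (inord n); rewrite inordK// => <-.
    exact: le_bigmax.
  apply: bigmax_le => // x _; rewrite tvE; apply: le_e; exact: le.
- have [n nN le_n] := @tv_ge_exp R S _ g0 gle i1 (lne _ ne1).
  by exists n => // t t0; have := le_n t t0; rewrite /= invrK.
Qed.
End Chain.

(** * Mixing times and cutoff *)

(** A closed set contains its infimum; under these hypotheses the default value is excluded. *)
Lemma set_min_attained (R : realType) (A : set R) (z : R) :
  closed A -> A !=set0 -> lbound A z -> A (set_min A) /\ lbound A (set_min A).
Proof.
move=> cA A0 Az; have hA : has_inf A by split=> //; exists z.
have : A (inf A).
  apply: cA => U /nbhs_ballP[e /= e0 eU].
  have [a Aa ae] := inf_adherent e0 hA.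
  exists a; split=> //; apply: eU; rewrite /ball/= ler0_norm ?subr_le0 ?ge_inf//.
    by rewrite opprB ltrBlDl.
  exact: (proj2 hA).
rewrite /set_min; case: xgetP => [a _ []//|/(_ (inf A)) + Ai].
by case; split=> //; apply: ge_inf; exact: (proj2 hA).
Qed.

Lemma tv_continuous (R : realType) (B : bd_flow R) (n : nat) :
  (n <= top B)%N -> continuous (fun t : R => tv B t n).
Proof.
move=> nN t; rewrite /tv; apply: cvgMl_tmp.
under eq_cvg do rewrite big_mkord; rewrite big_mkord.
apply: (@cvg_big _ _ +%R) => [|y _]; first exact: add_continuous.
apply: cvg_norm; apply: cvgB; last exact: cvg_cst.
have yN : (y <= top B)%N by rewrite -ltnS.
have kE (s : R) : ker B s n y = evolve (top B) (ker B) s (fun z => (z == y)%:R) n.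
  rewrite /evolve big_mkord (bigD1 y)//= eqxx mulr1 big1 ?addr0// => z zy.
  by rewrite (_ : (z == y :> nat) = false) ?mulr0//; apply: negPf.
under eq_cvg do rewrite kE; rewrite kE.
have := ker_derive (fun z => (z == y)%:R) t nN => d.
exact/differentiable_continuous/derivable1_diffP/ex_derive.
Qed.

Section Mixing.
Context {R : realType}.
Implicit Types (X : bd_chain R) (e t : R).

(** The set of admissible times is closed by continuity of the distances, and nonempty by the upper
    half of [tv_profile]. *)
Lemma tmixP X e : irreducible X -> 0 < e ->
  [/\ 0 <= tmix X e, mix_dist X (tmix X e) <= e &
    forall t, 0 <= t -> mix_dist X t <= e -> tmix X e <= t].
Proof.
move=> irr e0; have [B [_ dP _]] := bd_flow_of_chain irr.
pose S := [set t | 0 <= t /\ mix_dist X t <= e].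
have cS : closed S.
  have -> : S = [set t | 0 <= t] `&`
      \bigcap_(n in [set n | (n <= top B)%N]) (fun t => tv B t n) @^-1` [set v | v <= e].
    by apply/seteqP; split => t [t0] /=; [move=> /(dP t e (ltW e0))|move=> tn; split=> //; apply/(dP t e (ltW e0))].
  apply: closedI; first exact: closed_ge.
  apply: closed_bigI => n /= nN; apply: closed_comp; last exact: closed_le.
  by move=> t _; exact: tv_continuous.
have [A A0 [up _]] := tv_profile B.
have S0 : S !=set0.
  (* [tv_profile] requires a level at most 1/4 and returns 7 times it. *)
  pose e' := Num.min (e / 7) 4^-1.
  have e'0 : 0 < e' by rewrite lt_min; apply/andP; split; lra.
  have e'4 : e' <= 4^-1 by rewrite ge_min lexx orbT.
  have e'7 : 7 * e' <= e.
    have : e' <= e / 7 by rewrite ge_min lexx.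
    lra.
  pose t := A + (Num.sqrt (8 * relax B * A) / e' + relax B + 3 * relax B / e' ^+ 4).
  have r0 := relax_gt0 B.
  exists t; split.
    have i0 : 0 <= e'^-1 by rewrite invr_ge0 ltW.
    have i4 : 0 <= (e' ^+ 4)^-1 by rewrite invr_ge0 exprn_ge0// ltW.
    have r3 : 0 <= 3 * relax B by rewrite mulr_ge0// ltW.
    by rewrite /t !addr_ge0 ?(mulr_ge0 (sqrtr_ge0 _) i0) ?(mulr_ge0 r3 i4) ?(ltW r0).
  apply/(dP t e (ltW e0)) => n nN; apply: le_trans e'7; apply: (up _ t) => //.
  by rewrite e'0.
have Sl : lbound S 0 by move=> t [].
have [[t0 te] tl] := set_min_attained cS S0 Sl.
by split => // t t0' td; apply: tl.
Qed.

Lemma tmix_noninc X e e' : irreducible X -> 0 < e -> e <= e' ->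
  tmix X e' <= tmix X e.
Proof.
move=> irr e0 ee'; have [t0 te _] := tmixP irr e0.
have [_ _ min] := tmixP irr (lt_le_trans e0 ee').
exact: min (le_trans te ee').
Qed.

Lemma trel_gt0 X : irreducible X -> 0 < trel X.
Proof. by move=> irr; have [B [<- _ _]] := bd_flow_of_chain irr; exact: relax_gt0. Qed.

Lemma expR_tmix_le X e : irreducible X -> 0 < e ->
  expR (- tmix X e / trel X) <= 2 * e.
Proof.
move=> irr e0; have [t0 te _] := tmixP irr e0.
have [B [rB dP [n nN le_n]]] := bd_flow_of_chain irr.
rewrite -rB; apply: le_trans (le_n _ t0) _; rewrite ler_pM2l//.
by move/(dP _ _ (ltW e0)): te => /(_ n nN).
Qed.

(** At level 1/4 the exponential bound reads [expR (- T / trel) <= 1/2], and [1 - T / trel] is below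
    the left side. *)
Lemma trel_le_tmix X : irreducible X -> trel X <= 2 * tmix X 4^-1.
Proof.
move=> irr; have r0 := trel_gt0 irr.
have e4 : 0 < (4^-1 : R) by rewrite invr_gt0.
have le1 := expR_tmix_le irr e4.
have := le_trans (expR_ge1Dx (- tmix X 4^-1 / trel X)) le1.
have : tmix X 4^-1 / trel X * trel X = tmix X 4^-1 by rewrite divfK// gt_eqF.
nra.
Qed.

(** Upper bound: level [e / 7] and [sqrt 8 <= 3], whence [21 / e]. Lower bound: [b] and [D] are
    [5 / e] times [trel] and the square root, so the two losses are [e / 5] and [8 / 25 * e ^+ 2],
    together less than [e]. *)
Lemma tmix_profile X : irreducible X -> exists2 A : R, 0 <= A &
  forall e, 0 < e < 1 ->
    tmix X e <= A + (21 / e + 1 + 3 / (e / 7) ^+ 4) * (Num.sqrt (trel X * A) + trel X) /\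
    A - 5 / e * (Num.sqrt (trel X * A) + trel X) <= tmix X (1 - e).
Proof.
move=> irr; have r0 := trel_gt0 irr.
have [B [rB dP _]] := bd_flow_of_chain irr.
have [A A0 [up lo]] := tv_profile B; exists A => // e /andP[e0 e1].
rewrite rB in up lo; set s := Num.sqrt (trel X * A).
have s0 : 0 <= s := sqrtr_ge0 _.
have sE : s ^+ 2 = trel X * A by rewrite sqr_sqrtr// mulr_ge0// ltW.
split.
  have [_ _ min] := tmixP irr e0.
  have s8 : Num.sqrt (8 * trel X * A) <= 3 * s.
    rewrite -(@ler_pXn2r _ 2)// ?nnegrE ?sqrtr_ge0 ?mulr_ge0//.
    have rA : 0 <= trel X * A by rewrite mulr_ge0// ltW.
    rewrite sqr_sqrtr -?mulrA ?(mulr_ge0 _ rA)// exprMn sE; lra.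
  pose e' := e / 7.
  have e'0 : 0 < e' by rewrite divr_gt0.
  set t := A + _.
  have i0 : 0 < e'^-1 by rewrite invr_gt0.
  have i4 : 0 <= (e' ^+ 4)^-1 by rewrite invr_ge0 exprn_ge0// ltW.
  have le_t : A + (Num.sqrt (8 * trel X * A) / e' + trel X + 3 * trel X / e' ^+ 4) <= t.
    have h1 : Num.sqrt (8 * trel X * A) / e' <= 3 * s / e' by rewrite ler_wpM2r// ltW.
    have h2 : 21 / e = 3 / e' by rewrite /e'; field; rewrite gt_eqF.
    rewrite /t h2 -/e'.
    have h3 : 0 <= e'^-1 * trel X by rewrite mulr_ge0 ?ltW.
    have h4 : 0 <= s / e' ^+ 4 by rewrite mulr_ge0.
    lra.
  have t0 : 0 <= t.
    have r3 : 0 <= 3 * trel X by rewrite mulr_ge0// ltW.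
    apply: le_trans le_t.
    by rewrite !addr_ge0 ?(mulr_ge0 (sqrtr_ge0 _) (ltW i0)) ?(mulr_ge0 r3 i4) ?(ltW r0).
  apply: min => //; apply/(dP t e (ltW e0)) => n nN.
  have -> : e = 7 * e' by rewrite /e'; field.
  by apply: (up _ t) => //; rewrite e'0/= /e'; lra.
have e10 : 0 < 1 - e by rewrite subr_gt0.
have [t0 te _] := tmixP irr e10.
set t := tmix X (1 - e) in t0 te *; rewrite leNgt; apply/negP => lt_t.
have ei : 0 < e^-1 by rewrite invr_gt0.
have b0 : 0 < 5 / e * trel X by rewrite !mulr_gt0.
have D0 : 0 <= 5 / e * s by rewrite !mulr_ge0// ltW.
(* Positivity of [D] needs [A > 0]; it follows from [0 <= t] and the assumed strict bound on [t]. *)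
have Ap : 0 < A by lra.
have sp : 0 < s by rewrite sqrtr_gt0 mulr_gt0.
have Dp : 0 < 5 / e * s by rewrite !mulr_gt0.
have tle : 0 <= t <= A - 5 / e * trel X - 5 / e * s by rewrite t0/=; lra.
have [n nN] := lo _ _ _ b0 Dp tle.
move/(dP t (1 - e) (ltW e10)): te => /(_ n nN) tn tv_ge.
have := le_trans tv_ge tn.
have -> : trel X / (5 / e * trel X) = e / 5.
  by field; rewrite !gt_eqF.
have -> : 8 * trel X * A / (5 / e * s) ^+ 2 = 8 / 25 * e ^+ 2.
  rewrite -[8 * trel X * A]mulrA -sE; field.
  by rewrite !gt_eqF.
nra.
Qed.

(** [A] is traded for [T], the mixing time at level 1/4: the lower profile there,
    [s <= A / 16 + 4 * trel] and [trel <= 2 * T] give [A <= 122 * T]. Hence [s <= 12 * q] and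
    [trel <= 2 * q], and 14 is their sum. *)
Lemma mixing_window e : 0 < e < 1 -> exists2 C : R, 0 < C &
  forall X, irreducible X ->
    tmix X e - tmix X (1 - e) <= C * Num.sqrt (tmix X 4^-1 * trel X).
Proof.
move=> e01; have /andP[e0 e1] := e01.
pose K : R := (21 / e + 1 + 3 / (e / 7) ^+ 4) + 5 / e.
have ei : 0 < e^-1 by rewrite invr_gt0.
have K0 : 0 < K.
  have : 0 <= 3 / (e / 7) ^+ 4 by rewrite divr_ge0// exprn_ge0// divr_ge0// ltW.
  by rewrite /K; lra.
exists (14 * K) => [|X irr]; first by rewrite mulr_gt0.
have [A A0 prof] := tmix_profile irr.
have r0 := trel_gt0 irr; have rT := trel_le_tmix irr.
have [up lo] := prof _ e01.
have e34 : 0 < (3 / 4 : R) < 1 by apply/andP; split; lra.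
have [_] := prof _ e34; rewrite (_ : 1 - 3 / 4 = 4^-1 :> R); last by field.
set T := tmix X 4^-1 in rT *; set s := Num.sqrt (trel X * A) in up lo *.
have s0 : 0 <= s := sqrtr_ge0 _.
have sE : s ^+ 2 = trel X * A by rewrite sqr_sqrtr// mulr_ge0// ltW.
have sle : s <= A / 16 + 4 * trel X.
  rewrite -(@ler_pXn2r _ 2)// ?nnegrE; last by lra.
  rewrite sE; have := sqr_ge0 (A / 16 - 4 * trel X); lra.
move=> loT.
have AT : A <= 122 * T by move: loT; rewrite (_ : 5 / (3 / 4) = 20 / 3 :> R); [lra|field].
have T0 : 0 <= T by lra.
pose q := Num.sqrt (T * trel X).
have q0 : 0 <= q := sqrtr_ge0 _.
have qE : q ^+ 2 = T * trel X by rewrite sqr_sqrtr// mulr_ge0// ltW.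
have sq : s <= 12 * q.
  rewrite -(@ler_pXn2r _ 2)// ?nnegrE ?mulr_ge0// exprMn sE qE.
  have := ler_wpM2l (ltW r0) AT; have : 0 <= T * trel X by rewrite mulr_ge0// ltW.
  lra.
have rq : trel X <= 2 * q.
  rewrite -(@ler_pXn2r _ 2)// ?nnegrE ?mulr_ge0// ?(ltW r0)// exprMn qE.
  have := ler_wpM2r (ltW r0) rT; have : 0 <= T * trel X by rewrite mulr_ge0// ltW.
  rewrite expr2; lra.
have le1 : tmix X e - tmix X (1 - e) <= K * (s + trel X) by rewrite /K; lra.
apply: le_trans le1 _; rewrite -/q (_ : 14 * K * q = K * (14 * q)); last by ring.
rewrite ler_pM2l//; lra.
Qed.

End Mixing.

(** * Cutoff for sequences of chains *)

Theorem theorem3 (R : realType) (X : nat -> bd_chain R)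
    (hX : forall n, irreducible (X n)) :
  (cutoff X <->
     ((fun n => trel (X n)) =o_\oo (fun n => tmix (X n) 4^-1))) /\
  (cutoff X ->
     cutoff_window X (fun n => Num.sqrt (tmix (X n) 4^-1 * trel (X n)))).
Proof.
pose T n := tmix (X n) 4^-1.
have r0 n : 0 < trel (X n) := trel_gt0 (hX n).
have T0 n : 0 < T n by have := trel_le_tmix (hX n); have := r0 n; rewrite -/(T n); lra.
have gap_of_cutoff : cutoff X -> (fun n => trel (X n)) =o_\oo T.
  move=> cut; apply/eqoP => d d0.
  (* Chosen so that [2 * e < expR (- (2 / d))], which forces [tmix e > 2 / d * trel]; cutoff gives
     [tmix e < 2 * T], hence [trel < d * T]. *)
  pose e : R := expR (- (2 / d)) / 4.
  have e0 : 0 < e by rewrite divr_gt0 ?expR_gt0.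
  have e4 : e <= 4^-1.
    by rewrite /e ler_pdivrMr// mulVf// expR_le1 oppr_le0 divr_ge0// ltW.
  have e01 : 0 < e < 1 by rewrite e0/=; lra.
  have /cvgrPdist_lt/(_ (2^-1))/(_ _) near_r := cut _ e01.
  have h2 : 0 < (2^-1 : R) by rewrite invr_gt0.
  have {}near_r := near_r h2.
  near=> n; rewrite !gtr0_norm ?T0//.
  have : `|1 - tmix (X n) e / tmix (X n) (1 - e)| < 2^-1 by near: n.
  rewrite ltr_norml => /andP[ra rb].
  have irr := hX n.
  have e10 : 0 < 1 - e by rewrite subr_gt0; lra.
  have [t0 _ _] := tmixP irr e10.
  have tT : tmix (X n) (1 - e) <= T n by apply: tmix_noninc => //; lra.
  (* A zero denominator would make the quotient 0, at distance 1 from the limit. *)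
  have tp : 0 < tmix (X n) (1 - e).
    rewrite lt_def t0 andbT; apply/negP => /eqP z.
    by move: rb; rewrite z invr0 mulr0; lra.
  have lt2 : tmix (X n) e < 2 * tmix (X n) (1 - e) by rewrite -ltr_pdivrMr//; lra.
  have := expR_tmix_le irr e0.
  have : 2 * e < expR (- (2 / d)) by rewrite /e; have := expR_gt0 (- (2 / d)); lra.
  move=> h3 h4; have := le_lt_trans h4 h3.
  rewrite ltr_expR mulNr ltrN2 => h5.
  have h6 : 2 / d * trel (X n) < 2 * T n.
    apply: (@lt_trans _ _ (tmix (X n) e)); first by rewrite -ltr_pdivlMr.
    by apply: lt_le_trans lt2 _; rewrite ler_pM2l.
  have : 2 / d * trel (X n) * d < 2 * T n * d by rewrite ltr_pM2r.
  have -> : 2 / d * trel (X n) * d = 2 * trel (X n) by field; rewrite gt_eqF.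
  lra.
have near_gap : (fun n => trel (X n)) =o_\oo T ->
    forall d : R, 0 < d -> \forall n \near \oo, Num.sqrt (T n * trel (X n)) <= d * T n.
  move=> /eqoP o d d0; have d2 : 0 < d ^+ 2 by rewrite exprn_gt0.
  have := o _ d2; apply: filterS => n; rewrite !gtr0_norm ?T0// => le_r.
  rewrite -(@ler_pXn2r _ 2)// ?nnegrE ?sqrtr_ge0 ?mulr_ge0 ?(ltW d0) ?(ltW (T0 n))//.
  rewrite sqr_sqrtr ?mulr_ge0 ?(ltW (T0 n)) ?(ltW (r0 n))//.
  have := ler_wpM2l (ltW (T0 n)) le_r; rewrite exprMn; lra.
split; last first.
  move=> cut; have o := gap_of_cutoff cut; split.
    apply/eqoP => d d0; have := near_gap o d d0; apply: filterS => n.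
    by rewrite ger0_norm ?sqrtr_ge0// (gtr0_norm (T0 n)).
  move=> e e01; have [C C0 le_C] := mixing_window e01.
  by exists C => // n; exact: le_C.
split=> // o e /andP[e0 e1].
(* One level below [e], [1 - e] and 1/4: both mixing times of the quotient lie between those at
   [1 - a] and [a], and [T] is at most the latter. *)
pose a := Num.min (Num.min e (1 - e)) 4^-1.
have a0 : 0 < a by rewrite !lt_min e0 subr_gt0 e1 invr_gt0/=.
have ae : a <= e by rewrite /a !ge_min lexx.
have ae1 : a <= 1 - e by rewrite /a !ge_min lexx orbT.
have a4 : a <= 4^-1 by rewrite /a ge_min lexx orbT.
have a01 : 0 < a < 1 by rewrite a0/=; lra.
have [C C0 le_C] := mixing_window a01.
apply/cvgrPdist_le => d d0.
(* The bound [k <= 1/2] keeps the denominator at least [T / 2]; then [k <= d / 2] makes the relative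
   error at most [d]. *)
pose k := Num.min (d / 2) 2^-1.
have k0 : 0 < k by rewrite lt_min divr_gt0//= invr_gt0.
have kd : k <= d / 2 by rewrite /k ge_min lexx.
have k2 : k <= 2^-1 by rewrite /k ge_min lexx orbT.
have kC : 0 < k / C by rewrite divr_gt0.
have := near_gap o _ kC; apply: filterS => n le_s; have irr := hX n.
have diff : tmix (X n) a - tmix (X n) (1 - a) <= k * T n.
  apply: le_trans (le_C _ irr) _; rewrite -/(T n).
  have := ler_wpM2l (ltW C0) le_s.
  by rewrite (_ : C * (k / C * T n) = k * T n)//; field; rewrite gt_eqF.
have h1 : T n <= tmix (X n) a by apply: tmix_noninc.
have h2 : tmix (X n) e <= tmix (X n) a by apply: tmix_noninc.
have h3 : tmix (X n) (1 - e) <= tmix (X n) a by apply: tmix_noninc.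
have h4 : tmix (X n) (1 - a) <= tmix (X n) e by apply: tmix_noninc => //; lra.
have h5 : tmix (X n) (1 - a) <= tmix (X n) (1 - e).
  by apply: tmix_noninc => //; lra.
have kT : k * T n <= 2^-1 * T n by rewrite ler_pM2r.
have tp : 0 < tmix (X n) (1 - e) by have := T0 n; lra.
have -> : 1 - tmix (X n) e / tmix (X n) (1 - e) =
    (tmix (X n) (1 - e) - tmix (X n) e) / tmix (X n) (1 - e).
  by field; rewrite gt_eqF.
rewrite normrM normfV (gtr0_norm tp) ler_pdivrMr//.
have kdT : k * T n <= d / 2 * T n by rewrite ler_pM2r.
have le_half : d * (T n / 2) <= d * tmix (X n) (1 - e).
  by rewrite ler_pM2l//; lra.
by rewrite ler_norml; apply/andP; split; lra.
Unshelve. all: by end_near. Qed.
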